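(* Let $\Delta$ be a building such that every panel of $\Delta$ is contained in at least $4$ chambers, and let $\Sigma$ be an apartment of $\Delta$. Then for every convex subcomplex $\kappa$ of $\Sigma$ there exists an apartment $\Sigma'$ of $\Delta$ such that $\kappa=\Sigma\cap\Sigma'$.
   Context: Buildings are finite-dimensional simplicial complexes (chamber complexes admitting a system of apartments satisfying Tits' axioms), of arbitrary type; they need not be thick. Chambers are the maximal simplices, panels the simplices of codimension 1. ''Apartment of $\Delta$'', without further specification, means a member of the complete (i.e. maximal) system of apartments of $\Delta$; if $\Delta$ is of type $(W,S)$ these are exactly the simplicial subcomplexes of $\Delta$ isomorphic to the standard Coxeter complex $\Sigma(W,S)$. Two chambers are adjacent if they are different and share a panel; a gallery of length $n$ is a sequence $(C_0,\dots,C_n)$ of chambers with $C_{i-1},C_i$ adjacent for all $i$; $\mathrm{d}(C,D)$ is the minimal length of a gallery from $C$ to $D$. A chamber subcomplex is convex if it contains every gallery of minimal length $\mathrm{d}(C,D)$ between any two of its chambers $C,D$. An arbitrary subcomplex is convex if it is an intersection of convex chamber subcomplexes. (A subcomplex of a Coxeter complex is convex if and only if it is an intersection of roots, i.e. of images of foldings.) *)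

(* Defs.v *)
From HB Require Import structures.
From mathcomp Require Import all_boot finmap.
From mathcomp Require Import boolp classical_sets functions cardinality.

Set Implicit Arguments.
Unset Strict Implicit.
Unset Printing Implicit Defensive.

Local Open Scope classical_set_scope.

(* A simplicial complex is given by its set of simplices, which are finite    *)
(* sets of elements of an ambient type V. The empty simplex always belongs to *)
(* a complex, so an empty intersection is [set fset0]; elements of V which  *)
(* are not vertices of the complex are ignored.                               *)

Section Complexes.
Variable V : choiceType.
Implicit Types (X Y K : set {fset V}) (A B C D P : {fset V}) (p q : seq {fset V}).

Definition simplicial_complex X : Prop :=
  X fset0 /\ forall A B, X A -> (B `<=` A)%fset -> X B.

Definition subcomplex X K : Prop := simplicial_complex K /\ K `<=` X.

Definition vertex X (v : V) : Prop := X [fset v]%fset.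

Definition chamber X C : Prop :=
  X C /\ forall A, X A -> (C `<=` A)%fset -> A = C.

(* Only used when all chambers of X have the same cardinality. *)
Definition panel X P : Prop :=
  exists C, [/\ chamber X C, (P `<=` C)%fset & #|` C| = #|` P|.+1].

Definition adjacent X C D : Prop :=
  [/\ chamber X C, chamber X D, C <> D &
      exists P, [/\ panel X P, (P `<=` C)%fset & (P `<=` D)%fset]].

(* (C, p_1, ..., p_n) with p = [:: p_1; ...; p_n] is a gallery of length n. *)
Definition gallery X C p : Prop :=
  chamber X C /\ path (fun A B => `[< adjacent X A B >]) C p.

Definition minimal_gallery X C p : Prop :=
  gallery X C p /\
  forall q, gallery X C q -> last C q = last C p -> size p <= size q.

Definition chamber_complex X : Prop :=
  [/\ simplicial_complex X,
      exists n, forall A, X A -> #|` A| <= n,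
      forall C D, chamber X C -> chamber X D -> #|` C| = #|` D| &
      forall C D, chamber X C -> chamber X D ->
        exists2 p, gallery X C p & last C p = D].

Definition chamber_subcomplex X K : Prop :=
  [/\ subcomplex X K, chamber_complex K & chamber K `<=` chamber X].

Definition convex_chamber_subcomplex X K : Prop :=
  chamber_subcomplex X K /\
  forall C p, minimal_gallery X C p -> K C -> K (last C p) ->
    forall D, D \in p -> K D.

Definition convex_subcomplex X K : Prop :=
  subcomplex X K /\
  exists F : set (set {fset V}),
    [/\ F !=set0, F `<=` convex_chamber_subcomplex X & K = \bigcap_(L in F) L].

Definition complex_isomorphism X Y (f : V -> V) : Prop :=
  (forall u v, vertex X u -> vertex X v -> f u = f v -> u = v) /\
  [set (f @` A)%fset | A in X] = Y.

End Complexes.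

Section CoxeterSystems.
Variable W : groupType.
Implicit Types (S J H : set W).

Definition is_subgroup H : Prop :=
  H 1%g /\ forall x y, H x -> H y -> H (x * y^-1)%g.

Definition generated_subgroup J : set W := smallest is_subgroup J.

(* The last two clauses say that W = < S | (s t)^m(s,t) = 1 >, where m(s,t)   *)
(* is the order of s t. The condition on f quantifies over all n with         *)
(* (s t)^n = 1 in W: it says that (f s f t)^m(s,t) = 1 if m(s,t) is finite,   *)
(* and is void otherwise. The values of f outside S are irrelevant.           *)
Definition coxeter_system S : Prop :=
  [/\ finite_set S,
      forall s, S s -> s <> 1%g /\ (s * s)%g = 1%g,
      generated_subgroup S = setT &
      forall (G : groupType) (f : W -> G),
        (forall s t n, S s -> S t ->
           ((s * t) ^+ n)%g = 1%g -> ((f s * f t) ^+ n)%g = 1%g) ->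
        exists phi : {multiplicative W -> G}, forall s, S s -> phi s = f s].

Definition standard_cosets S : set (set W) :=
  [set Q | exists w J, J `<=` S /\
                       Q = [set (w * x)%g | x in generated_subgroup J]].

End CoxeterSystems.

(* Sigma(W, S) is the poset of standard cosets ordered by reverse inclusion;  *)
(* simplicial complexes are isomorphic iff their posets of simplices are.     *)
Definition coxeter_complex (V : choiceType) (X : set {fset V}) : Prop :=
  simplicial_complex X /\
  exists (W : groupType) (S : set W), coxeter_system S /\
  exists phi : {fset V} -> set W,
    set_bij X (standard_cosets S) phi /\
    forall A B, X A -> X B -> ((A `<=` B)%fset <-> phi B `<=` phi A).

Section Buildings.
Variable V : choiceType.
Implicit Types (Delta Sigma : set {fset V}) (Apts : set (set {fset V})).

Definition apartment_system Delta Apts : Prop :=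
  [/\ forall Sigma, Apts Sigma -> subcomplex Delta Sigma,
      forall Sigma, Apts Sigma -> coxeter_complex Sigma,
      forall A B, Delta A -> Delta B ->
        exists Sigma, [/\ Apts Sigma, Sigma A & Sigma B] &
      forall Sigma Sigma' A B, Apts Sigma -> Apts Sigma' ->
        Sigma A -> Sigma B -> Sigma' A -> Sigma' B ->
        exists f, complex_isomorphism Sigma Sigma' f /\
                  forall v, v \in (A `|` B)%fset -> f v = v].

(* Thickness is not required. *)
Definition building Delta : Prop :=
  chamber_complex Delta /\ exists Apts, apartment_system Delta Apts.

(* A union of apartment systems of a building is again an apartment system,   *)
(* so the union of all of them is the largest one.                            *)
Definition complete_apartment_system Delta : set (set {fset V}) :=
  \bigcup_(Apts in apartment_system Delta) Apts.

Definition apartment Delta Sigma : Prop := complete_apartment_system Delta Sigma.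

Definition chambers_containing Delta (P : {fset V}) : set {fset V} :=
  [set C | chamber Delta C /\ (P `<=` C)%fset].

End Buildings.

(* Main.v *)
From HB Require Import structures.
Require Import Defs.
From mathcomp Require Import all_boot finmap.
From mathcomp Require Import boolp classical_sets functions cardinality.

(* The proof works with the Weyl distance [d : Ch -> Ch -> W] of the building. An
   apartment is the image of an isometry [W -> Ch], partial isometries extend to [W]
   (Zorn), and the convex subcomplexes of an apartment [a] are the intersections of
   half-apartments. Choose a simplex [A] of minimal cotype [J] in kappa; then kappa lies
   in all the walls through [A], so kappa is the intersection of a convex chamber
   subcomplex containing a chamber [C] of [A] with the walls of the panels [s \in J]
   of [C].
   If [J] is empty, one extends the identity of the convex chamber set by sending each
   chamber adjacent to it to a chamber outside [a]; a minimal gallery starting in the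
   convex set then shows that the intersection is not larger.
   The walls are then added one at a time. If [f] meets [a] in the subcomplex for [J],
   keep the half of [f] beyond the wall of [s] and replace the other half, starting
   from a new chamber [E] of the [s]-panel of [f 1]. Two choices of [E] are excluded
   because they lie in [f], and at most one further choice meets [a] outside the wall:
   this is where four chambers per panel are needed. *)

Set Implicit Arguments.
Unset Strict Implicit.
Unset Printing Implicit Defensive.

Local Open Scope group_scope.
Local Open Scope classical_set_scope.
Local Open Scope card_scope.

(** * Coxeter groups: reflections, length, parabolic subgroups *)

(** That chambers [C] and [D] share their face of cotype [L] is recorded as [G L (d C D)], so
    simplices are handled as cosets and vertices only return with the labelled charts. The obstacle
    is a kappa without chambers: the gate argument that bounds the intersection starts from a
    chamber common to both apartments, and once a wall is imposed none is left. Shared simplices can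
    then be compared only through their projections to the star of a common face. Such projections
    are computed with shortest double coset representatives, whence the study of intersections of
    conjugate parabolic subgroups. *)

Section Twisted.
Variable W : groupType.

(* [s |-> (s, [pred1 s])] extends to a morphism from [W] to this semidirect product; its
   second component sends [w] to the set of reflections whose wall separates [1] and [w]. *)
Definition twisted : Type := (W * (W -> bool))%type.
HB.instance Definition _ := gen_eqMixin twisted.
HB.instance Definition _ := gen_choiceMixin twisted.

Definition twmul (a b : twisted) : twisted :=
  (a.1 * b.1, fun t => a.2 t (+) b.2 (t ^ a.1)).
Definition twone : twisted := (1, fun=> false).
Definition twinv (a : twisted) : twisted := (a.1^-1, fun t => a.2 (t ^ a.1^-1)).

Lemma twmulA : associative twmul.
Proof.
move=> [x f] [y g] [z h]; rewrite /twmul /= mulgA; congr (_, _).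
by apply/funext => t; rewrite conjgM addbA.
Qed.
Lemma twmul1 : left_id twone twmul.
Proof.
by move=> [x f]; rewrite /twmul /= mul1g; congr (_, _); apply/funext => t;
  rewrite conjg1.
Qed.
Lemma twmul1r : right_id twone twmul.
Proof.
by move=> [x f]; rewrite /twmul /= mulg1; congr (_, _); apply/funext => t;
  rewrite addbF.
Qed.
Lemma twmulV : left_inverse twone twinv twmul.
Proof.
by move=> [x f]; rewrite /twmul /twinv /= mulVg; congr (_, _); apply/funext => t;
  rewrite addbb.
Qed.
Lemma twmulVr : right_inverse twone twinv twmul.
Proof.
move=> [x f]; rewrite /twmul /twinv /= mulgV; congr (_, _); apply/funext => t.
by rewrite conjgK addbb.
Qed.
HB.instance Definition _ :=
  isGroup.Build twisted twmulA twmul1 twmul1r twmulV twmulVr.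

End Twisted.

Section Generated.
Variables (W : groupType) (J : set W).

Lemma gen1 : generated_subgroup J 1.
Proof. by move=> H [[]]. Qed.
Lemma gen_in s : J s -> generated_subgroup J s.
Proof. by move=> Js H [_]; apply. Qed.
Lemma genV x : generated_subgroup J x -> generated_subgroup J x^-1.
Proof.
by move=> Gx H HJ; case: (HJ) => [[H1 HM] _]; rewrite -[_^-1]mul1g; apply: HM => //;
  exact: Gx.
Qed.
Lemma genM x y :
  generated_subgroup J x -> generated_subgroup J y -> generated_subgroup J (x * y).
Proof.
move=> Gx Gy H HJ; case: (HJ) => [[H1 HM] _].
by rewrite -[y]invgK; apply: HM; [exact: Gx | exact: (genV Gy)].
Qed.
Lemma genVE x : generated_subgroup J x^-1 <-> generated_subgroup J x.
Proof. by split=> /genV //; rewrite invgK. Qed.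
Lemma genMl x y : generated_subgroup J x ->
  generated_subgroup J (x * y) <-> generated_subgroup J y.
Proof. by move=> Gx; split=> [/(genM (genV Gx))|/(genM Gx)//]; rewrite mulKg. Qed.
Lemma genMr x y : generated_subgroup J y ->
  generated_subgroup J (x * y) <-> generated_subgroup J x.
Proof. by move=> Gy; split=> [/genM /(_ (genV Gy))|/genM /(_ Gy)//]; rewrite mulgK. Qed.
Lemma gen_conjE x y : generated_subgroup J y ->
  generated_subgroup J (x ^ y) <-> generated_subgroup J x.
Proof. by move=> Gy; rewrite /conjg genMl; [exact: genMr|exact: genV]. Qed.

Lemma gen_ind (J_sq : forall s, J s -> s * s = 1) (P : W -> Prop) : P 1 ->
  (forall s w, J s -> generated_subgroup J w -> P w -> P (s * w)) ->
  forall w, generated_subgroup J w -> P w.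
Proof.
move=> P1 PM.
pose H := [set x | forall w, generated_subgroup J w -> P w ->
  [/\ P (x * w), generated_subgroup J (x * w), P (x^-1 * w) &
      generated_subgroup J (x^-1 * w)]].
have sH : is_subgroup H.
  split=> [w Gw Pw|x y Hx Hy w Gw Pw]; first by rewrite invg1 mul1g.
  have [Py Gy Py' Gy'] := Hy w Gw Pw; have [Px Gx Px' Gx'] := Hx w Gw Pw.
  rewrite -!mulgA invgM invgK -mulgA; have [? ? _ _] := Hx _ Gy' Py'.
  by have [? ? _ _] := Hy _ Gx' Px'.
move=> w Gw; have HG : H w.
  apply: Gw; split=> // s Js v Gv Pv.
  have -> : s^-1 = s by apply: mulg1_eq; exact: J_sq.
  by split; try exact: PM; apply: genM => //; exact: gen_in.
by have [] := HG 1 gen1 P1; rewrite mulg1.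
Qed.

End Generated.

Lemma gen_sub (W : groupType) (J L : set W) : J `<=` L ->
  generated_subgroup J `<=` generated_subgroup L.
Proof. by move=> JL w Gw H [sH LH]; apply: Gw; split=> // x /JL /LH. Qed.

Lemma gen_closed (W : groupType) (J : set W) (H : set W) : is_subgroup H ->
  J `<=` H -> generated_subgroup J `<=` H.
Proof. by move=> sH JH w; apply. Qed.

Lemma gen_conj (W : groupType) (J L : set W) x :
  (forall j, J j -> generated_subgroup L (j ^ x)) ->
  forall v, generated_subgroup J v -> generated_subgroup L (v ^ x).
Proof.
move=> H v Gv; apply: (gen_closed (H := [set v | generated_subgroup L (v ^ x)]) _ _ Gv) => //.
split=> [|u w /= Gu Gw]; first by rewrite /= conj1g; exact: gen1.
by rewrite conjMg conjVg; apply: genM => //; exact: genV.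
Qed.

Lemma conjgg (W : groupType) (x : W) : x ^ x = x.
Proof. exact: mulKg. Qed.

(** * The reflection cocycle, word length and the exchange condition *)

Section Cocycle.
Variables (W : groupType) (S : set W).
Hypothesis cox : coxeter_system S.

Lemma simple_sq s : S s -> s * s = 1.
Proof. by case: cox => _ H _ _ /H []. Qed.
Lemma simpleV s : S s -> s^-1 = s.
Proof. by move=> /simple_sq; exact: mulg1_eq. Qed.
Lemma simple_neq1 s : S s -> s <> 1.
Proof. by case: cox => _ H _ _ /H []. Qed.
Lemma gen_simple w : generated_subgroup S w.
Proof. by case: cox => _ _ -> _. Qed.
Lemma simple_mulK s : S s -> cancel ( *%g s) ( *%g s).
Proof. by move=> Ss w; rewrite mulgA simple_sq// mul1g. Qed.
Lemma simple_mulKr s : S s -> cancel ( *%g^~ s) ( *%g^~ s).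
Proof. by move=> Ss w; rewrite /= -mulgA simple_sq// mulg1. Qed.

(** For [x = s * t], the word (s t)^j crosses the walls of the reflections x^i s, i < 2j; this is
    the parity with which [r] occurs among the first [k] of them. *)
Fixpoint dihedral_count (x s : W) k r : bool :=
  if k is k'.+1 then dihedral_count x s k' r (+) (r == x ^+ k' * s) else false.

Lemma dihedral_countD x s n m r : x ^+ n = 1 ->
  dihedral_count x s (n + m) r = dihedral_count x s n r (+) dihedral_count x s m r.
Proof.
move=> xn; elim: m => [|m IH] /=; first by rewrite addn0 addbF.
by rewrite addnS /= IH addbA expgnDr xn mul1g.
Qed.

(** By the universal property only the relations (s t)^n = 1 have to be checked in [twisted]. When
    x^n = 1 the 2n reflections x^i s repeat with period n, so each occurs an even number of times
    and the second component vanishes. *)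
Lemma reflection_cocycle : exists N : W -> W -> bool,
  (forall x y t, N (x * y) t = N x t (+) N y (t ^ x)) /\
  (forall s t, S s -> N s t = (t == s)).
Proof.
case: cox => _ _ _ /(_ (twisted W) (fun w => (w, fun t => t == w))) [].
  move=> s t n Ss St stn.
  pose x := s * t.
  have sx k : s * x ^- k = x ^+ k * s.
    elim: k => [|k IH]; first by rewrite expg0 invg1 mulg1 mul1g.
    rewrite expgSr invgM mulgA.
    have -> : s * x^-1 = x * s by rewrite /x invgM !simpleV// mulgA.
    by rewrite -mulgA IH mulgA -expgS expgSr.
  have eqc k y r : (r ^ (x ^+ k) == y) = (r == x ^+ k * y * x ^- k).
    apply/eqP/eqP => [<-|->]; rewrite /conjg; last by rewrite !mulgA mulVg mul1g mulgVK.
    by rewrite !mulgA mulgV mul1g mulgK.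
  have pw k : (((s, fun r => r == s) : twisted W) * (t, fun r => r == t)) ^+ k =
      (x ^+ k, dihedral_count x s (k + k)) :> twisted W.
    elim: k => [|k IH]; first by rewrite !expg0.
    rewrite expgSr IH; congr (_, _); first by rewrite expgSr.
    apply/funext => r; rewrite addnS addSn /= -addbA; congr (_ (+) (_ (+) _)).
      by rewrite eqc -mulgA sx mulgA -expgnDr.
    rewrite -conjgM.
    have -> : (r ^ (x ^+ k * s) == t) = (r ^ (x ^+ k) == x * s).
      have -> : x * s = t ^ s^-1 by rewrite /conjg invgK simpleV// mulgA.
      by rewrite conjgM; apply/eqP/eqP => [<-|->]; rewrite ?conjgK ?conjgKV.
    by rewrite eqc -!mulgA sx (mulgA s) -/x (mulgA x) -expgS mulgA -expgnDr addnS.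
  rewrite pw stn; congr (_, _); apply/funext => r.
  by rewrite dihedral_countD// addbb.
move=> phi phiS; exists (fun w => (phi w).2).
have phi1 w : (phi w).1 = w.
  move: w (gen_simple w); apply: (gen_ind simple_sq) => [|s w Ss _ IH].
    have : phi 1 * phi 1 = phi 1 by rewrite -gmulfM mulg1.
    by move=> /(congr1 ( *%g (phi 1)^-1)); rewrite mulKg mulVg => ->.
  by rewrite gmulfM phiS//=  IH.
split=> [x y t|s t Ss]; last by rewrite phiS.
by rewrite gmulfM /= phi1.
Qed.

Definition separates : W -> W -> bool := projT1 (cid reflection_cocycle).
Local Notation N := separates.

Lemma sepM x y t : N (x * y) t = N x t (+) N y (t ^ x).
Proof. by rewrite /separates; case: cid => ? []. Qed.
Lemma sep_simple s t : S s -> N s t = (t == s).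
Proof. by rewrite /separates; case: cid => ? [] ? /= /[apply]. Qed.
Lemma sep1 t : N 1 t = false.
Proof. by have := sepM 1 1 t; rewrite mulg1 conjg1 addbb. Qed.
Lemma sepV x t : N x^-1 t = N x (t ^ x^-1).
Proof.
by have := sepM x^-1 x t; rewrite mulVg sep1; case: (N x^-1 t); case: (N x _).
Qed.
Lemma sep_diff x y t : N y t = N x t (+) N (x^-1 * y) (t ^ x).
Proof. by rewrite -sepM mulVKg. Qed.

Definition reflection (t : W) := exists u s : W, S s /\ t = s ^ u.

Lemma refl_simple s : S s -> reflection s.
Proof. by move=> Ss; exists 1, s; rewrite conjg1. Qed.
Lemma reflJ t x : reflection t -> reflection (t ^ x).
Proof. by move=> [u [s [Ss ->]]]; exists (u * x), s; rewrite conjgM. Qed.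
Lemma refl_sq t : reflection t -> t * t = 1.
Proof. by move=> [u [s [Ss ->]]]; rewrite -conjMg simple_sq// conj1g. Qed.
Lemma refl_mulK t w : reflection t -> t * (t * w) = w.
Proof. by move=> Rt; rewrite mulgA refl_sq// mul1g. Qed.
Lemma sep_refl w t : N w t -> reflection t.
Proof.
move: w (gen_simple w) t; apply: (gen_ind simple_sq) => [t|s w Ss _ IH t];
  first by rewrite sep1.
rewrite sepM sep_simple//; case: eqP => [-> _|_ /IH]; first exact: refl_simple.
by move=> /(reflJ s^-1); rewrite conjgK.
Qed.
(** In [u^-1 * s * u] the contributions of [u^-1] and [u] to the cocycle at [t] are equal and
    cancel, leaving that of [s]. *)
Lemma sep_self t : reflection t -> N t t.
Proof.
move=> [u [s [Ss ->]]].
have E : (s ^ u) ^ u^-1 = s by rewrite conjgK.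
rewrite {1}[s ^ u]conjgE sepM sepV E sepM (sep_simple _ Ss) conjgg eqxx.
by case: (N u s).
Qed.
Lemma sep_mull t w : reflection t -> N (t * w) t = ~~ N w t.
Proof. by move=> Rt; rewrite sepM sep_self// conjgg. Qed.

Fixpoint expr (J : set W) n w : Prop :=
  if n is n'.+1 then exists s v, [/\ J s, w = s * v & expr J n' v] else w = 1.

Lemma expr_ex w : exists n, `[< expr S n w >].
Proof.
move: w (gen_simple w); apply: (gen_ind simple_sq) => [|s w Ss _ [n /asboolP H]];
  first by exists 0; apply/asboolP.
by exists n.+1; apply/asboolP; exists s, w.
Qed.

Definition len w := ex_minn (expr_ex w).

Lemma expr_len w : expr S (len w) w.
Proof. by rewrite /len; case: ex_minnP => n /asboolP. Qed.
Lemma len_min w n : expr S n w -> len w <= n.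
Proof. by move=> H; rewrite /len; case: ex_minnP => m _; apply; apply/asboolP. Qed.

Lemma len1 : len 1 = 0.
Proof. by apply/eqP; rewrite -leqn0; apply: len_min. Qed.
Lemma len0 w : len w = 0 -> w = 1.
Proof. by have := expr_len w; move=> /[swap] ->. Qed.
Lemma len_simple_mul s w : S s -> len (s * w) <= (len w).+1.
Proof. by move=> Ss; apply: len_min; exists s, w; split=> //; exact: expr_len. Qed.

Lemma expr_sub J n w : J `<=` S -> expr J n w -> expr S n w.
Proof.
by move=> JS; elim: n w => //= n IH w [s [v [/JS Ss -> /IH]]]; exists s, v.
Qed.

(** Multiplying by [t] deletes a letter of the word that crosses the wall of [t]. Words in [J] are
    kept as words in [J], which [gen_expr] relies on. *)
Lemma exchange J n w t : J `<=` S -> expr J n w -> N w t ->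
  exists2 m, m < n & expr J m (t * w).
Proof.
move=> JS; elim: n w t => [w t /= ->|n IH w t [s [v [Js -> Hv]]]]; first by rewrite sep1.
rewrite sepM sep_simple; last exact: JS.
case: eqP => [-> _|_ /= /(IH _ _ Hv)[m mn Hm]].
  by exists n => //; rewrite simple_mulK//; exact: JS.
exists m.+1 => //; exists s, (t ^ s * v); split=> //.
by rewrite /conjg !mulgA mulgV mul1g.
Qed.

Lemma sep_ltn w t : N w t -> len (t * w) < len w.
Proof.
move=> /(exchange (@subset_refl _ S) (expr_len w)) [m mn /len_min H]; exact: leq_ltn_trans H mn.
Qed.
Lemma nsep_ltn w t : reflection t -> ~~ N w t -> len w < len (t * w).
Proof.
by move=> Rt; rewrite -sep_mull// => /sep_ltn; rewrite refl_mulK.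
Qed.
Lemma sepE w t : reflection t -> N w t = (len (t * w) < len w).
Proof.
move=> Rt; apply/idP/idP; first exact: sep_ltn.
by move=> H; apply/negPn/negP => /(nsep_ltn Rt) /(ltn_trans H); rewrite ltnn.
Qed.

Lemma len_simple_down s w : S s -> N w s -> len w = (len (s * w)).+1.
Proof.
move=> Ss /sep_ltn H; apply/eqP; rewrite eqn_leq H andbT.
by have := len_simple_mul (s * w) Ss; rewrite simple_mulK.
Qed.
Lemma len_simple_up s w : S s -> ~~ N w s -> len (s * w) = (len w).+1.
Proof.
move=> Ss H; rewrite (@len_simple_down s (s * w))//; first by rewrite simple_mulK.
by rewrite sep_mull//; exact: refl_simple.
Qed.

Lemma len_ind (P : W -> Prop) : P 1 ->
  (forall s w, S s -> len (s * w) = (len w).+1 -> P w -> P (s * w)) -> forall w, P w.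
Proof.
move=> P1 PS w; move En: (len w) => n; elim: n w En => [w /len0 -> //|n IH w En].
have := expr_len w; rewrite En => -[s [v [Ss Ew Hv]]].
have lv : len v = n.
  apply/eqP; rewrite eqn_leq len_min//= -ltnS -En Ew; exact: len_simple_mul.
by rewrite Ew; apply: PS => //; [rewrite -Ew En lv | exact: (IH _ lv)].
Qed.

Lemma expr_snoc J n w s : expr J n w -> J s -> expr J n.+1 (w * s).
Proof.
elim: n w => [w -> Js|n IH w [r [v [Jr -> Hv]]] Js].
  by exists s, 1; rewrite mul1g mulg1.
exists r, (v * s); split; [by []|by rewrite mulgA|exact: IH].
Qed.
Lemma lenV w : len w^-1 = len w.
Proof.
have H n x : expr S n x -> expr S n x^-1.
  elim: n x => [x ->|n IH x [s [v [Ss -> /IH Hv]]]]; first by rewrite invg1.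
  by rewrite invgM (simpleV Ss); exact: expr_snoc.
have H2 x : len x^-1 <= len x by apply/len_min/H; exact: expr_len.
by apply/eqP; rewrite eqn_leq H2 -{1}[w]invgK H2.
Qed.
Lemma len_mul x y : len (x * y) <= len x + len y.
Proof.
elim/len_ind: x => [|s x Ss -> IH]; first by rewrite mul1g len1.
by rewrite -mulgA addSn; apply: leq_trans (len_simple_mul _ Ss) _.
Qed.
Lemma len_ind_r (P : W -> Prop) : P 1 ->
  (forall s w, S s -> len (w * s) = (len w).+1 -> P w -> P (w * s)) -> forall w, P w.
Proof.
move=> P1 PS w; rewrite -[w]invgK; elim/len_ind: w^-1 => [|s x Ss Hl IH].
  by rewrite invg1.
rewrite invgM (simpleV Ss); apply: PS => //.
by rewrite -{1}(simpleV Ss) -invgM !lenV.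
Qed.

Lemma len_mul_simple w s : S s -> len (w * s) = len (s * w^-1).
Proof. by move=> Ss; rewrite -lenV invgM (simpleV Ss). Qed.
Lemma len_mul_simple_neq w s : S s -> len (w * s) != len w.
Proof.
move=> Ss; rewrite (len_mul_simple _ Ss) -(lenV w).
have [Nw|Nw] := boolP (N w^-1 s); last by rewrite len_simple_up ?neq_ltn ?ltnSn ?orbT.
by rewrite (len_simple_down Ss Nw) neq_ltn ltnSn.
Qed.
Lemma len_simple s : S s -> len s = 1%N.
Proof. by move=> Ss; rewrite -[s]mulg1 len_simple_up ?sep1 ?len1. Qed.

Lemma len1_simple w : len w = 1%N -> S w.
Proof.
by have := expr_len w => /[swap] -> [s [v [Ss -> /= ->]]]; rewrite mulg1.
Qed.

Lemma sep_crossing w t : N w t -> exists u r v, [/\ S r, w = u * (r * v),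
  len w = (len u + len v).+1, t ^ u = r & ~~ N u t].
Proof.
elim/len_ind: w t => [t|s w Ss lsw IH t]; first by rewrite sep1.
rewrite sepM (sep_simple _ Ss); case: eqVneq => [->|ts] /= Nt.
  by exists 1, s, w; rewrite mul1g lsw len1 conjg1 sep1.
have [u [r [v [Sr Ew lw tu Nu]]]] := IH _ Nt.
have Nsu : ~~ N (s * u) t by rewrite sepM (sep_simple _ Ss) (negPf ts).
have lsu : len (s * u) = (len u).+1.
  apply/eqP; rewrite eqn_leq len_simple_mul//= -(leq_add2r (len v).+1).
  rewrite addSn addnS -lw -lsw Ew mulgA; apply: leq_trans (len_mul _ _) _.
  by rewrite leq_add2l len_simple_mul.
exists (s * u), r, v; split=> //; first by rewrite Ew mulgA.
- by rewrite lsw lw lsu addSn.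
- by rewrite conjgM.
Qed.

(** The wall of [t] separates [p] from [q]; folding along it brings them strictly closer. *)
Lemma len_fold p q t : reflection t -> N p t != N q t ->
  len (p^-1 * t * q) < len (p^-1 * q).
Proof.
move=> Rt; rewrite (sep_diff p q t) => H.
have {}H : N (p^-1 * q) (t ^ p) by move: H; case: (N p t); case: (N _ _).
have := sep_ltn H; congr (_ < _); congr len.
by rewrite /conjg -!mulgA mulVKg.
Qed.
Lemma len_unfold p q t : reflection t -> N p t = N q t ->
  len (p^-1 * q) < len (p^-1 * t * q).
Proof.
move=> Rt H; have := @len_fold p (t * q) t Rt.
by rewrite sep_mull// H -mulgA refl_mulK// mulgA; apply; case: (N q t).
Qed.

(** No wall is crossed by both factors. The induction moves the first letter of [v] to the end of
    [u], which preserves this. *)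
Lemma lenD u v : (forall t, N u t -> ~~ N v (t ^ u)) -> len (u * v) = len u + len v.
Proof.
elim/len_ind: v u => [u _|r v Sr lrv IH u H]; first by rewrite mulg1 len1 addn0.
have Nrv : N (r * v) r.
  by rewrite sep_mull; [rewrite sepE ?lrv -?leqNgt//|]; exact: refl_simple.
have Nu : ~~ N u (r ^ u^-1) by apply/negP => /H; rewrite conjgKV Nrv.
have lur : len (u * r) = (len u).+1.
  rewrite -lenV invgM (simpleV Sr) -(lenV u); apply: len_simple_up => //.
  by rewrite sepV.
rewrite mulgA (IH (u * r)) ?lur ?lrv ?addnS ?addSn// => t.
rewrite sepM (sep_simple _ Sr) => Nt.
have [E|/negPf E] := eqVneq (t ^ u) r.
  rewrite conjgM E conjgg.
  by have := Nrv; rewrite sep_mull//; exact: refl_simple.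
move: Nt; rewrite E addbF => /H; rewrite sepM (sep_simple _ Sr) E /=.
by rewrite conjgM.
Qed.

(** * Standard parabolic subgroups and shortest coset representatives *)

Section Parabolic.
Variable J : set W.
Hypothesis JS : J `<=` S.
Local Notation G := (generated_subgroup J).

Lemma parabolic_sq s : J s -> s * s = 1. Proof. by move=> /JS/simple_sq. Qed.

Lemma sep_gen w t : G w -> N w t -> G t.
Proof.
move=> Gw; move: w Gw t; apply: (gen_ind parabolic_sq) => [t|s v Js Gv IH t];
  first by rewrite sep1.
rewrite sepM sep_simple; last exact: JS.
have Gs : G s by exact: gen_in.
by case: eqP => [-> //|_ /IH]; rewrite gen_conjE.
Qed.

Lemma gen_expr w : G w -> expr J (len w) w.
Proof.
move=> Gw; move: w Gw; apply: (gen_ind parabolic_sq) => [|s v Js Gv IH]; first by rewrite len1.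
have [Nv|Nv] := boolP (N v s); last first.
  by rewrite len_simple_up//; [exists s, v|exact: JS].
have [m ml Hm] := exchange JS IH Nv.
suff -> : len (s * v) = m by [].
apply/eqP; rewrite eqn_leq (len_min (expr_sub JS Hm))/= -ltnS.
by rewrite -len_simple_down//; exact: JS.
Qed.

Lemma gen_simple_mem s : S s -> G s -> J s.
Proof.
move=> Ss Gs; have := gen_expr Gs.
rewrite (len_simple Ss).
by move=> [r [v [Jr -> /= ->]]]; rewrite mulg1.
Qed.

Lemma gen_len_ind (P : W -> Prop) : P 1 ->
  (forall s w, J s -> len (s * w) = (len w).+1 -> G w -> P w -> P (s * w)) ->
  forall w, G w -> P w.
Proof.
move=> P1 PS w Gw; elim/len_ind: w Gw => // s w Ss lsw IH Gsw.
have Js : J s.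
  apply: (gen_simple_mem Ss); apply: sep_gen Gsw _.
  by rewrite sep_mull ?sepE ?lsw -?leqNgt//; exact: refl_simple.
have Gw : G w by move: Gsw; rewrite genMl//; exact: gen_in.
by apply: PS => //; exact: IH.
Qed.

Definition coset_min y := forall v, G v -> len y <= len (y * v).

Lemma coset_min_ex x : exists2 v, G v & coset_min (x * v).
Proof.
have: exists n, `[< exists2 v, G v & len (x * v) = n >].
  by exists (len (x * 1)); apply/asboolP; exists 1 => //; exact: gen1.
move=> /ex_minnP [n /asboolP [v Gv <-] H]; exists v => // u Gu.
by rewrite -mulgA; apply: H; apply/asboolP; exists (v * u) => //; exact: genM.
Qed.

(** Otherwise [t * y = y * t ^ y] would be a shorter element of the same coset. *)
Lemma coset_min_sep y t : coset_min y -> N y t -> ~ G (t ^ y).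
Proof.
move=> ym /sep_ltn + Gt; have := ym _ Gt.
by rewrite /conjg mulVKg leqNgt => /negP.
Qed.

Lemma coset_minD y v : coset_min y -> G v -> len (y * v) = len y + len v.
Proof.
move=> ym Gv; apply: lenD => t /(coset_min_sep ym) nG; apply/negP => /(sep_gen Gv); exact: nG.
Qed.

End Parabolic.

(** The first letter of a reduced word of [w] lies in every [J i] by [sep_gen], so it can be peeled
    off. *)
Lemma gen_bigcap (I : Type) (P : set I) (J : I -> set W) : (exists i, P i) ->
  (forall i, P i -> J i `<=` S) -> forall w,
  (forall i, P i -> generated_subgroup (J i) w) ->
  generated_subgroup (\bigcap_(i in P) J i) w.
Proof.
move=> [i0 Pi0] JS w; elim/len_ind: w => [|s w Ss lsw IH H]; first by move=> _; exact: gen1.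
have Js i : P i -> J i s.
  move=> Pi; apply: (gen_simple_mem (JS _ Pi) Ss); apply: (sep_gen (JS _ Pi) (H _ Pi)).
  by rewrite sep_mull ?sepE ?lsw -?leqNgt//; exact: refl_simple.
apply: genM; first by apply: gen_in => i /Js.
by apply: IH => i Pi; have := H _ Pi; rewrite genMl//; apply: gen_in; exact: Js.
Qed.

(** * Shortest double coset representatives *)

Section DoubleCoset.
Variables J L : set W.
Hypotheses (JS : J `<=` S) (LS : L `<=` S).
Local Notation GJ := (generated_subgroup J).
Local Notation GL := (generated_subgroup L).

Definition dcoset_min d := forall u v, GJ u -> GL v -> len d <= len (u * d * v).

Lemma dcoset_min_ex x : exists u v d, [/\ GJ u, GL v, d = u * x * v & dcoset_min d].
Proof.
have: exists n, `[< exists u v, [/\ GJ u, GL v & len (u * x * v) = n] >].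
  by exists (len (1 * x * 1)); apply/asboolP; exists 1, 1; split=> //; exact: gen1.
move=> /ex_minnP [n /asboolP [u [v [Gu Gv <-]]] H].
exists u, v, (u * x * v); split=> // u' v' Gu' Gv'.
apply: H; apply/asboolP; exists (u' * u), (v * v'); rewrite !mulgA.
by split=> //; exact: genM.
Qed.

Lemma dcoset_min_r d : dcoset_min d -> coset_min L d.
Proof. by move=> H v Gv; have := H 1 v (@gen1 _ _) Gv; rewrite mul1g. Qed.

Lemma dcoset_min_sep d t : dcoset_min d -> GJ t -> ~~ N d t.
Proof.
move=> dm Gt; apply/negP => /sep_ltn; have := dm t 1 Gt (@gen1 _ _).
by rewrite mulg1 leqNgt => /negP.
Qed.

Lemma dcoset_min_lD d u : dcoset_min d -> GJ u -> len (u * d) = len u + len d.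
Proof.
move=> dm Gu; apply: lenD => t Nt; apply: dcoset_min_sep => //.
by rewrite gen_conjE//; exact: sep_gen Nt.
Qed.
Lemma dcoset_min_rD d v : dcoset_min d -> GL v -> len (d * v) = len d + len v.
Proof. by move=> dm; apply: coset_minD => //; exact: dcoset_min_r. Qed.

(** No wall of a reflection in [GJ] separates 1 from [d]. Hence the wall of the first letter [s] of
    [s * u] yields, after conjugation by [d], a wall crossed by [(s * u) ^ d], and [sep_gen] puts
    [s ^ d] in [GL]. *)
Lemma dcoset_min_cap d u : dcoset_min d -> GJ u -> GL (u ^ d) ->
  generated_subgroup [set j | J j /\ GL (j ^ d)] u.
Proof.
move=> dm Gu; move: u Gu; apply: (gen_len_ind JS) => [_|s u Js lsu Gu IH Gud].
  exact: gen1.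
have Ss := JS Js.
have Gs : GJ s by exact: gen_in.
have Ns : N (s * u) s by rewrite sep_mull ?sepE ?lsu -?leqNgt//; exact: refl_simple.
have GLs : GL (s ^ d).
  apply: (sep_gen LS Gud).
  have := sepM d ((s * u) ^ d) s; rewrite (negPf (dcoset_min_sep dm Gs)) /= => <-.
  rewrite /conjg mulVKg sepM Ns.
  by rewrite (negPf (dcoset_min_sep dm _)) // gen_conjE//; exact: genM.
apply: genM; first by apply: gen_in.
by apply: IH; move: Gud; rewrite conjMg genMl.
Qed.

(** Lengths add in both sides of [j * d = d * j ^ d], so [j ^ d] has length 1. *)
Lemma dcoset_min_conj_simple d j : dcoset_min d -> J j -> GL (j ^ d) -> L (j ^ d).
Proof.
move=> dm Jj GLj; apply: gen_simple_mem => //; apply: len1_simple.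
have Gj : GJ j by exact: gen_in.
have := dcoset_min_lD dm Gj; rewrite conjgC dcoset_min_rD// (len_simple (JS Jj)).
by rewrite addnC => /addIn.
Qed.

End DoubleCoset.

End Cocycle.

(** * Weyl distances and partial isometries *)

Section WeylDistance.
Variables (W : groupType) (S : set W).
Hypothesis cox : coxeter_system S.
Local Notation N := (separates cox).
Local Notation len := (len cox).
Local Notation G := generated_subgroup.
Variables (Ch : Type) (d : Ch -> Ch -> W).

Record weyl_distance : Prop := WeylDistance {
  wd_eq : forall C D, d C D = 1 <-> C = D;
  wd_sym : forall C D, d D C = (d C D)^-1;
  wd_weak : forall s C D E, S s -> d D E = s -> d C E = d C D \/ d C E = d C D * s;
  wd_strong : forall s C D E, S s -> d D E = s ->
    len (d C D) < len (d C D * s) -> d C E = d C D * s;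
  wd_ex : forall s C D, S s -> exists E, d D E = s /\ d C E = d C D * s }.

Hypothesis wd : weyl_distance.

Lemma wd_diag C : d C C = 1. Proof. by apply/(wd_eq wd). Qed.

Lemma wd_step s w D E F : S s -> d D E = s * w -> d E F = d E D * s -> d F E = w.
Proof.
move=> Ss Ew EF; rewrite (wd_sym wd E F) EF (wd_sym wd D E) Ew invgM invgK.
by rewrite (simpleV cox Ss) (simple_mulK cox Ss).
Qed.

Lemma wd_gen L C D E : L `<=` S -> G L (d D E) -> G L ((d C D)^-1 * d C E).
Proof.
move=> LS GDE.
suff H w : G L w -> forall D, d D E = w -> G L ((d C D)^-1 * d C E) by exact: H GDE _ _.
move: w; apply: gen_ind => [s /LS/(simple_sq cox)//|D'|s w Ls Gw IH D' Ew].
  by move=> /(wd_eq wd) ->; rewrite mulVg; exact: gen1.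
have [F [F1 F2]] := wd_ex wd E D' (LS _ Ls).
have EF := wd_step (LS _ Ls) Ew F2.
have := IH _ EF; case: (wd_weak wd C (LS _ Ls) F1) => ->//.
by rewrite invgM -mulgA genMl// genVE; exact: gen_in.
Qed.

Lemma wd_gen_trans L C D E : L `<=` S -> G L (d C D) -> G L (d D E) -> G L (d C E).
Proof. by move=> LS GCD /(wd_gen C LS); rewrite genMl//; exact: genV. Qed.
Lemma wd_gen_sym L C D : G L (d C D) -> G L (d D C).
Proof. by rewrite (wd_sym wd D C) genVE. Qed.

Lemma wd_add C D E : len (d C D * d D E) = len (d C D) + len (d D E) ->
  d C E = d C D * d D E.
Proof.
move Ew: (d D E) => w; elim/(@len_ind _ _ cox): w D Ew => [D /(wd_eq wd) -> _|s w Ss lsw IH D Ew].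
  by rewrite mulg1.
have [F [F1 F2]] := wd_ex wd E D Ss.
have EF := wd_step Ss Ew F2.
rewrite mulgA lsw addnS => H.
have H1 : len (d C D) < len (d C D * s).
  by have := len_mul cox (d C D * s) w; rewrite H -addSn leq_add2r.
have H2 := wd_strong wd Ss F1 H1.
rewrite -H2; apply: IH => //; rewrite H2 H.
rewrite -addSn; congr (_ + _)%N; apply/eqP; rewrite eqn_leq H1 /=.
by apply: leq_trans (len_mul _ _ _) _; rewrite (len_simple cox Ss) addn1.
Qed.

(* Retracting onto an apartment centred at [C] does not increase distances. *)
Lemma len_retract C D E : len ((d C D)^-1 * d C E) <= len (d D E).
Proof.
move Ew: (d D E) => w; elim/(@len_ind _ _ cox): w D Ew => [D /(wd_eq wd) ->|s w Ss lsw IH D Ew].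
  by rewrite mulVg len1.
have [F [F1 F2]] := wd_ex wd E D Ss.
have EF := wd_step Ss Ew F2.
rewrite lsw; have := IH _ EF; case: (wd_weak wd C Ss F1) => ->; first exact: leqW.
rewrite invgM -mulgA (simpleV cox Ss) => H.
by rewrite -[_ * _](simple_mulK cox Ss); apply: leq_trans (len_simple_mul _ _ Ss) _.
Qed.

Lemma panel_trans s C D E : S s -> d C D = s -> d C E = s -> D <> E -> d D E = s.
Proof.
move=> Ss CD CE DE; have DC : d D C = s by rewrite (wd_sym wd C) CD (simpleV cox).
by case: (wd_weak wd D Ss CE); rewrite DC// (simple_sq cox Ss) => /(wd_eq wd).
Qed.

(** A panel has a single chamber nearest to [C], its gate; a chamber that shares its distance with
    another one is not the gate. *)
Lemma gate_unique s C D E : S s -> d D E = s -> d C D = d C E ->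
  len (d C D * s) < len (d C D).
Proof.
move=> Ss DE CDE; rewrite ltn_neqAle len_mul_simple_neq//= leqNgt; apply/negP => H.
have := wd_strong wd Ss DE H; rewrite -CDE => /(congr1 ( *%g (d C D)^-1)).
by rewrite mulVg mulKg => /esym /(simple_neq1 cox Ss).
Qed.

(* A partial isometry is represented by its graph; injectivity and
   single-valuedness follow from [wd_eq]. *)
Definition partial_isometry (g : set (W * Ch)) :=
  forall p q, g p -> g q -> d p.2 q.2 = p.1^-1 * q.1.
Definition isometry (f : W -> Ch) := forall x y, d (f x) (f y) = x^-1 * y.

Lemma isometryM f g : isometry f -> isometry (fun x => f (g * x)).
Proof. by move=> fI x y; rewrite fI invgM -mulgA mulKg. Qed.

Lemma partial_fun g x C D : partial_isometry g -> g (x, C) -> g (x, D) -> C = D.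
Proof. by move=> gI gC gD; apply/(wd_eq wd); rewrite (gI _ _ gC gD) mulVg. Qed.

Lemma partial_add g x E : partial_isometry g ->
  (forall y D, g (y, D) -> d D E = y^-1 * x) -> partial_isometry (g `|` [set (x, E)]).
Proof.
move=> gI H [y C] [z D] [gy|[-> ->]] [gz|[-> ->]] /=.
- exact: (gI _ _ gy gz).
- exact: H gy.
- by rewrite (wd_sym wd D) (H _ _ gz) invgM invgK.
- by rewrite mulVg wd_diag.
Qed.

(** [C] is the gate of the panel for every chamber in the image of [g], so every other chamber of
    the panel is a possible value. *)
Lemma extend_free g c C s E : partial_isometry g -> g (c, C) -> S s -> d C E = s ->
  (forall y D, g (y, D) -> len (y^-1 * c) < len (y^-1 * c * s)) ->
  partial_isometry (g `|` [set (c * s, E)]).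
Proof.
move=> gI gc Ss CE H; apply: partial_add => // y D gy.
have yc := gI _ _ gy gc; rewrite /= in yc.
by rewrite (wd_strong wd Ss CE) yc; [rewrite mulgA|exact: H gy].
Qed.

(** Seen from [D0] the gate of the panel is not [C], so the value at [c * s] has to be the gate. The
    content is that this choice suits all other chambers in the image of [g]. *)
Lemma extend_forced g c C s y0 D0 : partial_isometry g -> g (c, C) -> S s ->
  g (y0, D0) -> len (y0^-1 * c * s) <= len (y0^-1 * c) ->
  exists E, [/\ d C E = s, d D0 E = y0^-1 * c * s &
    partial_isometry (g `|` [set (c * s, E)])].
Proof.
move=> gI gc Ss gy0 H0.
have y0c := gI _ _ gy0 gc; rewrite /= in y0c.
have [E [CE DE]] := wd_ex wd D0 C Ss; rewrite y0c in DE.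
exists E; split=> //; apply: partial_add => // y D gy.
have yc := gI _ _ gy gc; rewrite /= in yc.
have [H|H] := ltnP (len (y^-1 * c)) (len (y^-1 * c * s)).
  by rewrite (wd_strong wd Ss CE) yc// mulgA.
case: (wd_weak wd D Ss CE); rewrite yc ?mulgA// => ED; exfalso.
(* [p] and [q] are the positions of [D0] and [D] seen from [E]. They lie on opposite sides of the
   wall of [s], so folding makes [y0^-1 * y] shorter than [p^-1 * q], against [len_retract]. *)
pose p := s * c^-1 * y0; pose q := c^-1 * y.
have Ep : d E D0 = p by rewrite (wd_sym wd D0) DE !invgM invgK (simpleV cox Ss) mulgA.
have Eq : d E D = q by rewrite (wd_sym wd D) ED invgM invgK.
have lV x z : len (x^-1 * z) = len (z^-1 * x) by rewrite -lenV invgM invgK.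
have side x : len (x^-1 * c * s) <= len (x^-1 * c) -> N (c^-1 * x) s.
  move=> H1; have [//|Nv] := boolP (N _ _).
  have := len_simple_up Ss Nv; rewrite -lV.
  by rewrite -lenV !invgM !invgK (simpleV cox Ss) => E1; rewrite E1 ltnn in H1.
have Np : ~~ N p s.
  by rewrite /p -mulgA sep_mull ?side//; exact: refl_simple.
have Nq : N q s by exact: side.
have := @len_fold _ _ cox p q s (refl_simple Ss).
rewrite (negPf Np) Nq => /(_ isT); rewrite ltnNge => /negP; apply.
rewrite -{1}Ep -{1}Eq; apply: leq_trans (len_retract _ _ _) _.
rewrite (gI _ _ gy0 gy) /= /p /q !invgM !invgK (simpleV cox Ss).
by rewrite -!mulgA (simple_mulK cox Ss) mulVKg.
Qed.

Lemma partial_extend g c C s : partial_isometry g -> g (c, C) -> S s ->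
  exists E, partial_isometry (g `|` [set (c * s, E)]).
Proof.
move=> gI gc Ss.
have [[y [D [gy H]]]|H] := pselect (exists y D, g (y, D) /\
    len (y^-1 * c * s) <= len (y^-1 * c)).
  by have [E [_ _ HE]] := extend_forced gI gc Ss gy H; exists E.
have [E [CE _]] := wd_ex wd C C Ss; exists E; apply: extend_free CE _ => // y D gy.
by rewrite ltnNge; apply/negP => H1; apply: H; exists y, D.
Qed.

Lemma maximal_partial (g0 R : set (W * Ch)) : partial_isometry g0 -> g0 `<=` R ->
  exists g, [/\ partial_isometry g, g0 `<=` g, g `<=` R &
    forall p, R p -> partial_isometry (g `|` [set p]) -> g p].
Proof.
move=> g0I g0R.
(* [g0] is joined to the members rather than required inside them, so that the union of the empty
   chain is admissible. *)
have [F FP Ftot|A [AP Amax]] := @Zorn_bigcup _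
    [set g | partial_isometry (g0 `|` g) /\ g `<=` R].
  split; last by move=> p [X FX /(proj2 (FP _ FX))].
  move=> p q [gp|[X FX Xp]] [gq|[Y FY Yq]].
  - exact: g0I.
  - by case: (FP _ FY) => H _; apply: H; [left|right].
  - by case: (FP _ FX) => H _; apply: H; [right|left].
  case: (Ftot _ _ FX FY) => XY.
  - by case: (FP _ FY) => H _; apply: H; right => //; exact: XY.
  - by case: (FP _ FX) => H _; apply: H; right => //; exact: XY.
case: AP => AI AR; exists (g0 `|` A); split=> //.
  by move=> p [/g0R|/AR].
move=> p Rp pI; have [//|nA] := pselect ((g0 `|` A) p).
case: (Amax (A `|` [set p])).
  split; first by move=> q; left.
  by move=> H; apply: nA; right; apply: H; right.
by rewrite /= setUA; split=> // q [/AR//|->].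
Qed.

Lemma isometry_extend g x0 C0 : partial_isometry g -> g (x0, C0) ->
  exists2 f, isometry f & forall x C, g (x, C) -> f x = C.
Proof.
move=> gI gx0.
have [h [hI gh _ hmax]] := maximal_partial gI (@subsetT _ g).
have dom x : exists C, h (x, C).
  rewrite -(mulVKg x0 x); elim/(@len_ind_r _ _ cox): (x0^-1 * x) => [|s w Ss _ [C hC]].
    by exists C0; rewrite mulg1; exact: gh.
  have [E HE] := partial_extend hI hC Ss.
  by exists E; rewrite mulgA; apply: hmax.
have [f Hf] := choice dom; exists f => [x y|x C gx].
  exact: (hI _ _ (Hf x) (Hf y)).
exact: partial_fun (Hf x) (gh _ gx).
Qed.

End WeylDistance.

(** * Intersecting an apartment in a convex subcomplex *)

Section Intersection.
Variables (W : groupType) (S : set W).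
Hypothesis cox : coxeter_system S.
Local Notation N := (separates cox).
Local Notation len := (len cox).
Local Notation G := generated_subgroup.
Variables (Ch : Type) (d : Ch -> Ch -> W).
Hypothesis wd : weyl_distance cox d.
Hypothesis thick : forall C s D E, S s -> exists F, [/\ d C F = s, F <> D & F <> E].

(* The simplex of the Coxeter complex with coset [x * G L] lies in every
   half-space [{w | ~~ N w t}], [t \in T0], and on the wall of every [s \in J]. *)
Definition in_convex (T0 J : set W) x L :=
  (forall t, T0 t -> exists2 v, G L v & ~~ N (x * v) t) /\
  (forall s, J s -> G L (s ^ x)).

(** In the last clause [w] is independent of [x]: a shared simplex may a priori have different
    coordinates in the two apartments. *)
Definition meets_in (a : W -> Ch) (T0 J : set W) (f : W -> Ch) :=
  [/\ isometry d f,
    forall x L, L `<=` S -> in_convex T0 J x L -> G L (d (a x) (f x)) &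
    forall x w L, L `<=` S -> G L (d (a x) (f w)) -> in_convex T0 J x L].

(** * The case of a convex chamber subcomplex *)

Section Chambers.
Variable a : W -> Ch.
Hypothesis aI : isometry d a.
Variable T0 : set W.
Let K x := forall t, T0 t -> ~~ N x t.

Lemma leave_convex c s : S s -> K c -> ~ K (c * s) ->
  exists t, [/\ reflection S t, ~~ N c t, N (c * s) t, t ^ c = s &
     forall x, K x -> ~~ N x t].
Proof.
move=> Ss Kc /existsNP [t /not_implyP [Tt /negP]]; rewrite negbK => Nt.
have Nc := Kc _ Tt; exists t; split=> //.
- exact: sep_refl Nt.
- by move: Nt; rewrite sepM (negPf Nc) (sep_simple cox _ Ss) => /eqP.
- by move=> x; apply.
Qed.

Lemma avoid_outside : exists f, [/\ isometry d f, forall x, K x -> f x = a x &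
  forall c s, S s -> K c -> ~ K (c * s) -> f (c * s) <> a (c * s)].
Proof.
pose g0 : set (W * Ch) := [set p | K p.1 /\ p.2 = a p.1].
(* Outside [K] the domain is limited to neighbours of [K], and the value given by [a] is forbidden
   there. A partial isometry maximal within [R] will be defined at all these neighbours. *)
pose R : set (W * Ch) := [set p | K p.1 \/
  p.2 <> a p.1 /\ exists c s, [/\ S s, K c & p.1 = c * s]].
have g0I : partial_isometry d g0.
  by move=> [x C] [y D] [/= _ ->] [/= _ ->]; exact: aI.
have g0R : g0 `<=` R by move=> p [Kp _]; left.
have [g [gI g0g gR gmax]] := maximal_partial g0I g0R.
have K1 : K 1 by move=> t _; rewrite sep1.
have ga x : K x -> g (x, a x) by move=> Kx; exact: g0g.
have [f fI fg] := isometry_extend wd gI (ga _ K1).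
exists f; split=> // [x /ga /fg//|c s Ss Kc Kcs].
suff [E gE] : exists E, g (c * s, E).
  by rewrite (fg _ _ gE); case: (gR _ gE) => [/Kcs|[]].
suff [E [Ea EI]] : exists E, E <> a (c * s) /\ partial_isometry d (g `|` [set (c * s, E)]).
  by exists E; apply: gmax => //; right; split=> //; exists c, s.
have [[y [D [gy H]]]|H] := pselect (exists y D, g (y, D) /\
    len (y^-1 * c * s) <= len (y^-1 * c)); last first.
  have [F [cF Fa _]] := thick (a c) (a (c * s)) (a c) Ss.
  exists F; split=> //; apply: extend_free wd _ _ _ _ _ gI (ga _ Kc) Ss cF _ => y D gy.
  by rewrite ltnNge; apply/negP => H1; apply: H; exists y, D.
have [E [cE DE EI]] := extend_forced wd gI (ga _ Kc) Ss gy H.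
(* Suppose the forced value is [a (c * s)], and let [t] be the wall between [c] and [c * s]. Then
   [y] lies beyond it and is itself a neighbour of [K] across it. So [D] and [a y] are two chambers
   of one panel equally far from [a (c * s)], although [y], on the same side of [t] as [c * s], is
   the gate. *)
exists E; split=> // Ea.
have [t [Rt Nc Ncs tc tK]] := leave_convex Ss Kc Kcs.
have Ny : N y t.
  have [//|Ny] := boolP (N y t).
  have := @len_unfold _ _ cox y c t Rt; rewrite (negPf Ny) (negPf Nc).
  by move=> /(_ erefl); rewrite -mulgA (conjgC t) tc mulgA ltnNge H.
case: (gR _ gy) => /= [/tK|[Da [c1 [s1 [Ss1 Kc1 Ey]]]]]; first by rewrite Ny.
have tc1 : t ^ c1 = s1.
  by move: Ny; rewrite Ey sepM (negPf (tK _ Kc1)) (sep_simple cox _ Ss1) => /eqP.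
have d1 : d (a c1) D = s1 by rewrite (gI _ _ (ga _ Kc1) gy) /= Ey mulKg.
have d2 : d (a c1) (a y) = s1 by rewrite aI Ey mulKg.
have d3 := panel_trans wd Ss1 d1 d2 Da.
have d4 : d (a (c * s)) D = (c * s)^-1 * y.
  by rewrite -Ea (wd_sym wd D) DE !invgM invgK mulgA.
have := gate_unique wd Ss1 d3 (_ : d (a (c * s)) D = _).
rewrite d4 aI => /(_ erefl).
have := @len_unfold _ _ cox (c * s) y t Rt; rewrite Ny Ncs => /(_ erefl).
have -> : (c * s)^-1 * t * y = (c * s)^-1 * y * s1.
  by rewrite -[RHS]mulgA -[LHS]mulgA Ey (mulgA t) (conjgC t) tc1.
by move=> H1 H2; have := ltn_trans H1 H2; rewrite ltnn.
Qed.

Lemma meets_in_chambers : exists f, meets_in a T0 set0 f.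
Proof.
have [f [fI fK fN]] := avoid_outside; exists f; split=> // [x L LS [xT _]|x w L LS H].
  (* The chamber of the coset nearest to 1 lies in every half-space that contains 1 and meets the
     coset. *)
  have [v Gv ym] := coset_min_ex cox L x.
  have Ky : K (x * v).
    move=> t Tt; apply/negP => Ny.
    have [v' Gv' Nv'] := xT _ Tt; apply: (coset_min_sep ym Ny).
    apply: (sep_gen LS (genM (genV Gv) Gv')).
    have := sep_diff cox (x * v) (x * v') t; rewrite Ny (negPf Nv').
    by rewrite invgM -mulgA mulKg; case: (N _ _).
  apply: (wd_gen_trans wd LS (_ : G L (d (a x) (a (x * v))))).
    by rewrite aI mulKg.
  by rewrite -(fK _ Ky) fI invgM mulgVK; exact: genV.
(* Equality passes down a reduced word: if [f c] and [a c] differed, both would be equally far from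
   [f 1 = a 1] and nearer than the rest of their panel. *)
have agreeK y : f y = a y -> K y.
  elim/(@len_ind_r _ _ cox): y => [_|s c Ss lcs IH Ef]; first by move=> t _; rewrite sep1.
  have [//|nK] := pselect (K (c * s)).
  suff /IH Kc : f c = a c by case: (fN _ _ Ss Kc nK).
  have [//|ne] := pselect (f c = a c).
  have d1 : d (f (c * s)) (f c) = s by rewrite fI invgM mulgVK (simpleV cox Ss).
  have d2 : d (f (c * s)) (a c) = s by rewrite Ef aI invgM mulgVK (simpleV cox Ss).
  have d3 := panel_trans wd Ss d1 d2 ne.
  have f1 : f 1 = a 1 by apply: fK => t _; rewrite sep1.
  have := gate_unique wd Ss d3 (_ : d (f 1) (f c) = d (f 1) (a c)).
  rewrite {2}f1 fI aI => /(_ erefl).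
  by rewrite invg1 mul1g lcs ltnNge leqnSn.
have [v Gv ym] := coset_min_ex cox L x.
have [v' Gv' ym'] := coset_min_ex cox L w.
have f1 : f 1 = a 1 by apply: fK => t _; rewrite sep1.
have H' : G L (d (a (x * v)) (f (w * v'))).
  apply: (wd_gen_trans wd LS (_ : G L (d (a (x * v)) (a x)))).
    by rewrite aI invgM mulgVK; exact: genV.
  by apply: (wd_gen_trans wd LS H); rewrite fI mulKg.
have e1 : d (a 1) (a (x * v)) = x * v by rewrite aI invg1 mul1g.
have e2 : d (a 1) (f (w * v')) = w * v' by rewrite -f1 fI invg1 mul1g.
have E1 : d (a 1) (f (w * v')) = x * v * d (a (x * v)) (f (w * v')).
  by rewrite (wd_add wd (D := a (x * v))) ?e1// (coset_minD LS).
set u := d (a (x * v)) (f (w * v')) in H' E1.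
have E0 : w * v' = x * v * u by rewrite -E1 e2.
have E2 : x * v = w * v' * u^-1 by rewrite E0 mulgK.
(* [a (x * v)] and [f (w * v')] are both the chamber nearest to [a 1 = f 1] around the shared
   simplex: lengths add in both directions, so [u] is trivial. *)
have u0 : len u = 0.
  have l1 := coset_minD LS ym H'; have l2 := coset_minD LS ym' (genV H').
  rewrite -E0 in l1; rewrite -E2 lenV l1 in l2.
  move/eqP: l2; rewrite -{1}[len (x * v)]addn0 -addnA eqn_add2l eq_sym.
  by rewrite addn_eq0 => /andP[/eqP].
have E3 : a (x * v) = f (w * v') by apply/(wd_eq wd); exact: len0 u0.
have E4 : w * v' = x * v by rewrite -e1 E3 e2.
have Ky : K (x * v) by apply: agreeK; rewrite E3 E4.
by split=> // t /Ky Nt; exists v.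
Qed.

End Chambers.

(** Projects the shared simplex with coset [x * G L] to the star of the shared face of cotype [M],
    in both apartments at once. Computing [d (a p) (c (q * e))] through [c q] and through
    [a (p * e)] gives the last clause. With [dcoset_min_cap] it says that [a p] and [c q] share a
    face whose cotype consists of the [j] in [M] with [j ^ e] in [G L]. *)
Lemma common_projection M L a c x y : M `<=` S -> L `<=` S ->
  isometry d a -> isometry d c -> G M (d (a 1) (c 1)) -> G L (d (a x) (c y)) ->
  exists e p q, [/\ dcoset_min cox M L e, G M p /\ G M q, G L (x^-1 * (p * e)),
    G L (y^-1 * (q * e)) & G M (d (a p) (c q)) /\ G L (d (a p) (c q) ^ e)].
Proof.
move=> MS LS aI cI H1 Hxy.
have m1 := wd_gen wd (a x) MS H1; rewrite aI mulg1 invgK in m1.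
have l1 := wd_gen wd (c 1) LS Hxy; rewrite cI invg1 mul1g (wd_sym wd _ (c 1)) invgK in l1.
have [u [v [e [Gu Gv Ee em]]]] := dcoset_min_ex cox M L x.
exists e, u^-1, ((x * d (a x) (c 1))^-1 * u^-1).
have Gu' := genV Gu.
have E1 : G L (x^-1 * (u^-1 * e)) by rewrite Ee -!mulgA !mulKg.
have Gq : G M ((x * d (a x) (c 1))^-1 * u^-1) by apply: genM => //; exact: genV.
set q := _ * u^-1 in Gq *.
have E2 : G L (y^-1 * (q * e)).
  rewrite -(genMl _ l1) mulgA mulgK /q Ee -!mulgA mulKg invgM -!mulgA !mulVKg mulKg.
  exact: Gv.
split=> //.
have Gpq : G M (d (a u^-1) (c q)).
  apply: (wd_gen_trans wd MS (_ : G M (d (a u^-1) (a 1)))).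
    by rewrite aI mulg1 invgK.
  by apply: (wd_gen_trans wd MS H1); rewrite cI invg1 mul1g.
have Gw : G L (d (a (u^-1 * e)) (c (q * e))).
  apply: (wd_gen_trans wd LS (_ : G L (d (a (u^-1 * e)) (a x)))).
    by rewrite aI -genVE invgM invgK.
  by apply: (wd_gen_trans wd LS Hxy); rewrite cI.
have e1 : d (c q) (c (q * e)) = e by rewrite cI mulKg.
have e2 : d (a u^-1) (a (u^-1 * e)) = e by rewrite aI mulKg.
have F1 : d (a u^-1) (c (q * e)) = d (a u^-1) (c q) * e.
  by rewrite (wd_add wd (D := c q)) e1// (dcoset_min_lD MS em).
have F2 : d (a u^-1) (c (q * e)) = e * d (a (u^-1 * e)) (c (q * e)).
  by rewrite (wd_add wd (D := a (u^-1 * e))) e2// (dcoset_min_rD LS em).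
by split=> //; rewrite /conjg -F1 F2 mulKg.
Qed.

(** The near halves of [f] and [g] form an apartment. A reduced word of [x^-1 * (s * y)] crosses the
    wall at some [z]; there [f z] and [g z] are distinct chambers of one panel, and the gallery
    through them from [f x] to [g y] has additive length. *)
Lemma glue f g s : isometry d f -> isometry d g -> S s ->
  (forall x, N x s -> f x = g x) -> f 1 <> g 1 ->
  forall x y, ~~ N x s -> ~~ N y s -> d (f x) (g y) = x^-1 * (s * y).
Proof.
move=> fI gI Ss fg f1 x y Nx Ny.
have Rs := refl_simple Ss.
have Nw : N (x^-1 * (s * y)) (s ^ x).
  by have := sep_diff cox x (s * y) s; rewrite sep_mull// Ny (negPf Nx) /= => <-.
have [u [r [v [Sr Ew lw sur Nu]]]] := sep_crossing Nw.
pose z := x * u.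
have szr : s * z = z * r by rewrite conjgC -sur conjgM.
have Nz : ~~ N z s by rewrite sepM (negPf Nx).
have Nzr : N (z * r) s by rewrite -szr sep_mull.
have Ev : v = z^-1 * y.
  have : s * y = z * r * v by rewrite /z -!mulgA -Ew mulVKg.
  by rewrite -szr -mulgA => /(mulgI s) ->; rewrite mulKg.
have lur : len (u * r) = (len u + 1)%N.
  apply/eqP; rewrite eqn_leq; apply/andP; split.
    by rewrite -(len_simple cox Sr); exact: len_mul.
  by rewrite -(leq_add2r (len v)) addn1 addSn -lw Ew mulgA; exact: len_mul.
have fz : d (f (z * r)) (f z) = r by rewrite fI invgM mulgVK (simpleV cox).
have gz : d (f (z * r)) (g z) = r by rewrite fg// gI invgM mulgVK (simpleV cox).
have fgz : f z <> g z.
  move=> Ez; have d1 : d (f s) (f 1) = s by rewrite fI mulg1 (simpleV cox).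
  have Ns : N s s by exact: sep_self.
  have d2 : d (f s) (g 1) = s by rewrite fg// gI mulg1 (simpleV cox).
  have d3 := panel_trans wd Ss d1 d2 f1.
  have := gate_unique wd Ss d3 (_ : d (f z) (f 1) = d (f z) (g 1)).
  rewrite {2}Ez fI gI => /(_ erefl).
  by rewrite mulg1 len_mul_simple// invgK len_simple_up// lenV ltnNge leqnSn.
have d1 := panel_trans wd Sr fz gz fgz.
have d2 : d (f x) (f z) = u by rewrite fI mulKg.
have d3 : d (f x) (g z) = u * r.
  by rewrite (wd_add wd (D := f z)) d1 d2// (len_simple cox Sr).
have d4 : d (g z) (g y) = v by rewrite gI.
by rewrite (wd_add wd (D := g z)) d3 d4 -mulgA -Ew// lw lur addn1 addSn.
Qed.

Definition glued (f g : W -> Ch) s w := if N w s then g (s * w) else f w.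

Lemma glued_isometry f g s : isometry d f -> isometry d g -> S s ->
  (forall x, N x s -> f x = g x) -> f 1 <> g 1 -> isometry d (glued f g s).
Proof.
move=> fI gI Ss fg f1 x y; rewrite /glued.
have Nm w : N w s -> ~~ N (s * w) s by rewrite sep_mull ?negbK//; exact: refl_simple.
have ss : s^-1 = s := simpleV cox Ss.
case: ifP => Nx; case: ifP => Ny.
- by rewrite gI invgM -mulgA mulKg.
- rewrite (wd_sym wd) (glue fI gI Ss fg f1) ?Ny ?Nm//.
  by rewrite (simple_mulK cox Ss) invgM invgK.
- by rewrite (glue fI gI Ss fg f1) ?Nx ?Nm// (simple_mulK cox Ss).
- exact: fI.
Qed.

(** * Adding one wall *)

Section Wall.
Variables (a : W -> Ch) (T0 : set W) (js : seq W) (s : W) (f : W -> Ch).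
Let J := [set` js].
Hypotheses (aI : isometry d a) (JS : J `<=` S) (Ss : S s) (Ts : T0 s).
Hypotheses (ujs : uniq (s :: js)) (fJ : meets_in a T0 J f).
Let J' := [set` s :: js].

Let fI : isometry d f. Proof. by case: fJ. Qed.
Let nJs : ~ J s. Proof. by case/andP: ujs => /negP. Qed.
Let JJ' : J `<=` J'. Proof. by move=> j Jj; rewrite /J' /= inE Jj orbT. Qed.
Let J's : J' s. Proof. by rewrite /J' /= inE eqxx. Qed.
Let J'S : J' `<=` S. Proof. by move=> j; rewrite /J' /= inE => /orP[/eqP ->//|/JS]. Qed.

Lemma gen_nsep p : G J p -> ~~ N p s.
Proof. by move=> Gp; apply/negP => /(sep_gen JS Gp) /(gen_simple_mem cox JS Ss). Qed.

Let f1 : G J (d (a 1) (f 1)).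
Proof.
case: fJ => _ H _; apply: H => //; split=> [t _|j Jj].
  by exists 1; [exact: gen1 | rewrite mulg1 sep1].
by rewrite conjg1; exact: gen_in.
Qed.

(** [a] and [g] share a simplex that lies, as seen in [g], in the near half of the wall of [s] and
    off the wall. *)
Definition wall_bad g := exists x w L, [/\ L `<=` S, G L (d (a x) (g w)) &
  forall v, G L v -> ~~ N (w * v) s].

Section Bad.
Variable g : W -> Ch.
Hypotheses (gI : isometry d g) (fg : forall x, N x s -> f x = g x) (fg1 : f 1 <> g 1).

(** Normal form of a bad simplex: its coordinates in [a] and [g] are [e] and [s * e], and [e]
    conjugates [G L] into [G J]. All such simplices are thus comparable with the face of cotype
    [J]. *)
Lemma wall_bad_reduce : wall_bad g -> exists L e, [/\ L `<=` S,
  G L (d (a e) (g (s * e))), ~~ N (s * e) s & forall v, G L v -> G J (v ^ e^-1)].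
Proof.
move=> [x [w [L0 [L0S Hxw sL0]]]].
have Rs := refl_simple Ss; have Ns : N s s by exact: sep_self.
have g1 : G J' (d (a 1) (g 1)).
  apply: (wd_gen_trans wd J'S (gen_sub JJ' f1)).
  apply: (wd_gen_trans wd J'S (_ : G J' (d (f 1) (f s)))).
    by rewrite fI invg1 mul1g; exact: gen_in.
  by rewrite fg// gI mulg1; apply: genV; exact: gen_in.
(* [a] and [g] share a face of cotype [J']; the projection of the bad simplex to its star is again
   bad, which is [sL] below. *)
have [e [p [q [em [Gp Gq] _ E2 [Gpq Gpqe]]]]] :=
  common_projection J'S L0S aI gI g1 Hxw.
pose L := [set j | J' j /\ G L0 (j ^ e)].
have LS : L `<=` S by move=> j [/J'S].
have Lpq : G L (d (a p) (g q)) by exact: (dcoset_min_cap J'S L0S em Gpq Gpqe).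
have Le v : G L v -> G L0 (v ^ e).
  by move: v; apply: gen_conj => j [].
have LJ' v : G L v -> G J' v by apply: gen_sub => j [].
have sL v : G L v -> ~~ N (q * v) s.
  move=> Gv; apply/negP => Nqv.
  have := sL0 (w^-1 * (q * e) * v ^ e) (genM E2 (Le _ Gv)).
  have -> : w * (w^-1 * (q * e) * v ^ e) = q * v * e.
    by rewrite -[X in w * X]mulgA mulVKg -mulgA -conjgC mulgA.
  rewrite sepM Nqv /=.
  rewrite negbK; apply/negP; apply: (dcoset_min_sep em).
  by apply/gen_conjE; [apply: genM => //; exact: LJ' | exact: gen_in].
have Nq : ~~ N q s by rewrite -[q]mulg1; apply: sL; exact: gen1.
(* On the near side [h] is [f], so projecting to the star of the face of cotype [J] yields a simplex
   shared by [a] and [f], to which [fJ] applies. It lies in all the walls of [J], and therefore [L2]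
   is [J]. *)
pose h := glued f g s.
have hI : isometry d h by exact: glued_isometry.
have h1 : G J (d (a 1) (h 1)) by rewrite /h /glued sep1.
have hsq : h (s * q) = g q by rewrite /h /glued sep_mull// Nq (simple_mulK cox Ss).
have Hp : G L (d (a p) (h (s * q))) by rewrite hsq.
have [k [p2 [q2 [km [Gp2 Gq2] F1 F2 [Gpq2 Gpqk]]]]] :=
  common_projection JS LS aI hI h1 Hp.
pose L2 := [set j | J j /\ G L (j ^ k)].
have L2J : L2 `<=` J by move=> j [].
have L2pq : G L2 (d (a p2) (f q2)).
  have := dcoset_min_cap JS LS km Gpq2 Gpqk.
  by rewrite /h /glued (negPf (gen_nsep Gq2)).
have [_ _ f2] := fJ.
have [_ p2J] := f2 _ _ _ (subset_trans L2J JS) L2pq.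
have JL j : J j -> L (j ^ k).
  move=> Jj; apply: (dcoset_min_conj_simple JS LS km Jj).
  suff : L2 j by case.
  apply: (gen_simple_mem cox (subset_trans L2J JS)); first exact: JS.
  rewrite -(conjgKV p2 j).
  have : G J (j ^ p2^-1) by apply/gen_conjE; [exact: genV | exact: gen_in].
  by move: (j ^ p2^-1); exact: gen_conj.
have JLG v : G J v -> G L (v ^ k).
  by move: v; apply: gen_conj => j /JL/gen_in.
(* If [L] were all of [J'], the coset of [q] would contain [s], which is beyond the wall. So [L] has
   no more elements than [J], and conjugation by [k] maps [J] onto [L]. *)
have nLJ : exists2 j, j \in s :: js & ~ L j.
  apply/not_exists2P => H.
  have := sL (q^-1 * s); rewrite mulVKg Ns => /(_ _)/negP[] //.
  apply: (@gen_sub _ J'); first by move=> j jj; case: (H j) => // /contrapT.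
  by apply: genM; [exact: genV | exact: gen_in].
pose ls := [seq j <- s :: js | `[< L j >]].
have lsP j : L j -> j \in ls.
  by move=> Lj; rewrite mem_filter; apply/andP; split; [exact/asboolP|case: Lj].
have sub : {subset [seq j ^ k | j <- js] <= ls}.
  by move=> _ /mapP[j Jj ->]; apply: lsP; exact: JL.
have szls : size ls <= size [seq j ^ k | j <- js].
  rewrite size_map -ltnS -[(size js).+1]/(size (s :: js)) size_filter ltn_neqAle
    count_size andbT -all_count.
  by have [j jj nLj] := nLJ; apply/negP => /allP /(_ _ jj) /asboolP.
have ucj : uniq [seq j ^ k | j <- js].
  by rewrite map_inj_uniq; [case/andP: ujs | exact: conjg_inj].
have [_ eqls] := uniq_min_size ucj sub szls.
have LJG v : G L v -> G J (v ^ k^-1).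
  move: v; apply: gen_conj => l /lsP; rewrite -eqls => /mapP[j Jj ->];
    rewrite conjgK; exact: gen_in.
(* [r * k = k * r ^ k] with [r ^ k] in [G L], so [p2] and [q2] are absorbed. *)
have shift r x0 : G J r -> G L (x0^-1 * (r * k)) -> G L (x0^-1 * k).
  move=> Gr; rewrite conjgC => H; rewrite -(genMr _ (JLG _ Gr)) -mulgA; exact: H.
have {}F1 := shift _ _ Gp2 F1; have {}F2 := shift _ _ Gq2 F2.
have F3 : q^-1 * (s * k) = (s * q)^-1 * k by rewrite invgM (simpleV cox Ss) -mulgA.
exists L, k; split=> //.
  apply: (wd_gen_trans wd LS (_ : G L (d (a k) (a p)))).
    by rewrite aI -genVE invgM invgK.
  by apply: (wd_gen_trans wd LS Lpq); rewrite gI F3.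
by rewrite -(mulVKg q (s * k)) F3; exact: sL.
Qed.
End Bad.

(* Two bad chambers of the panel would give two half-apartments [g1], [g2] beyond
   the wall meeting [a] in simplices [A1], [A2]; comparing the Weyl distance of
   [A1] and [A2] inside [a] and inside [g1 \cup g2] puts [s] in [G J]. *)
Lemma wall_bad_unique g1 g2 : isometry d g1 -> isometry d g2 ->
  (forall x, N x s -> f x = g1 x) -> (forall x, N x s -> f x = g2 x) ->
  f 1 <> g1 1 -> f 1 <> g2 1 -> wall_bad g1 -> wall_bad g2 -> g1 1 = g2 1.
Proof.
move=> g1I g2I fg1 fg2 f1g1 f1g2 b1 b2; have [//|ne] := pselect (g1 1 = g2 1).
have [L1 [e1 [L1S H1 Ne1 C1]]] := wall_bad_reduce g1I fg1 f1g1 b1.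
have [L2 [e2 [L2S H2 Ne2 C2]]] := wall_bad_reduce g2I fg2 f1g2 b2.
have fg x : N x s -> g1 x = g2 x by move=> Nx; rewrite -fg1// fg2.
have := glue g1I g2I Ss fg ne Ne1 Ne2.
rewrite (simple_mulK cox Ss) invgM (simpleV cox Ss) => E.
have K2 := wd_gen wd (g1 (s * e1)) L2S H2.
have K1 := wd_gen wd (a e2) L1S H1.
have {K1}K1 : G L1 (e1^-1 * e2 * (d (g1 (s * e1)) (a e2))^-1).
  by move: K1; rewrite aI (wd_sym wd _ (a e2)) invgM invgK.
move: K2; set l := d _ _ in E K1 *; rewrite E => K2.
(* The conjugates are [e2 * l^-1 * e1^-1] and the same element times [s]; both lie in [G J]. *)
have {K1} := C1 _ K1; have {K2} := C2 _ K2; rewrite /conjg !invgK !mulgA mulgV mul1g.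
rewrite !mulgK => G2 G1; case: nJs; apply: (gen_simple_mem cox JS Ss).
by move: G2; rewrite genMl.
Qed.

Lemma in_convexM x v K L : G L v -> in_convex T0 K (x * v) L -> in_convex T0 K x L.
Proof.
move=> Gv [H1 H2]; split=> [t /H1 [u Gu]|j /H2].
  by rewrite -mulgA; exists (v * u) => //; exact: genM.
by rewrite conjgM => /gen_conjE; apply.
Qed.

Lemma meets_in_wall : exists g, meets_in a T0 J' g.
Proof.
have Rs := refl_simple Ss; have Ns : N s s by exact: sep_self.
have [E0 bad0] : exists E0, forall g, isometry d g -> (forall x, N x s -> f x = g x) ->
    f 1 <> g 1 -> wall_bad g -> g 1 = E0.
  have [[g0 [g0I fg0 f1g0 b0]]|H] := pselect (exists g, [/\ isometry d g,
      forall x, N x s -> f x = g x, f 1 <> g 1 & wall_bad g]).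
    by exists (g0 1) => g gI fg f1g b; exact: wall_bad_unique b b0.
  (* Without bad extensions [f 1] serves as a default, being excluded anyway. *)
  by exists (f 1) => g gI fg f1g b; case: H; exists g.
have [E [sE E1 EE0]] := thick (f s) (f 1) E0 Ss.
pose h : set (W * Ch) := [set p | N p.1 s /\ p.2 = f p.1].
have hI : partial_isometry d h by move=> [x C] [y D] [/= _ ->] [/= _ ->]; exact: fI.
have hs : h (s, f s) by [].
have h'I : partial_isometry d (h `|` [set (s * s, E)]).
  apply: (extend_free wd hI hs Ss sE) => y D [/= Ny _].
  rewrite -mulgA (simple_sq cox Ss) mulg1 len_mul_simple// invgK lenV.
  exact: sep_ltn.
have [g gI hg] := isometry_extend wd h'I (or_introl hs).
have fg x : N x s -> f x = g x by move=> Nx; rewrite (hg x (f x))//; left.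
have g1 : g 1 = E by rewrite -(simple_sq cox Ss); apply: hg; right.
have f1g : f 1 <> g 1 by rewrite g1 => /esym.
have nbad : ~ wall_bad g by move=> b; apply: EE0; rewrite -g1; exact: bad0.
have [_ fin fout] := fJ.
have inJ x L : in_convex T0 J' x L -> in_convex T0 J x L.
  by move=> [H1 H2]; split=> // j /JJ'/H2.
exists g; split=> // [x L LS xL|x w L LS Hxw].
  (* The simplex lies in the wall of [s], so its coset has a chamber beyond the wall, where [g] is
     [f]. *)
  have Gsx : G L (s ^ x) by case: xL => _; apply.
  have [Nx|Nx] := boolP (N x s); first by rewrite -fg//; apply: fin => //; exact: inJ.
  have Esx : s * x = x * s ^ x by exact: conjgC.
  have H : G L (d (a (x * s ^ x)) (g (x * s ^ x))).
    rewrite -fg; last by rewrite -Esx sep_mull.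
    apply: fin => //; apply: inJ; apply: (in_convexM (v := (s ^ x)^-1)); first exact: genV.
    by rewrite mulgK.
  apply: (wd_gen_trans wd LS (_ : G L (d (a x) (a (x * s ^ x))))).
    by rewrite aI mulKg.
  apply: (wd_gen_trans wd LS H); rewrite gI invgM mulgVK; exact: genV.
have [v Gv Nwv] : exists2 v, G L v & N (w * v) s.
  apply/not_exists2P => H; apply: nbad; exists x, w, L; split=> // v Gv.
  by apply/negP => Nv; case: (H v).
have Hxwv : G L (d (a x) (f (w * v))).
  by rewrite fg//; apply: (wd_gen_trans wd LS Hxw); rewrite gI mulKg.
have [xT xJ] := fout _ _ _ LS Hxwv.
have Hx : G L (d (a x) (f x)) by apply: fin => //; split.
have Gxw : G L (x^-1 * (w * v)).
  by rewrite -fI; apply: (wd_gen_trans wd LS (wd_gen_sym wd Hx)).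
split=> // j; rewrite /J' /= inE => /orP[/eqP->|/xJ//].
(* As [s] is in [T0], the coset also has a chamber on the near side; meeting both sides, the simplex
   lies in the wall. *)
have [u Gu Nu] := xT _ Ts.
have := sep_diff cox (x * u) (w * v) s; rewrite Nwv (negPf Nu) /= invgM -mulgA => /esym H.
have := sep_gen LS (genM (genV Gu) Gxw) H.
by rewrite conjgM => /gen_conjE; apply.
Qed.

End Wall.

Theorem meets_in_exists a T0 (js : seq W) : isometry d a -> [set` js] `<=` S ->
  [set` js] `<=` T0 -> uniq js -> exists f, meets_in a T0 [set` js] f.
Proof.
move=> aI; elim: js => [_ _ _|s js IH jS jT ujs].
  have -> : [set` [::]] = set0 :> set W by apply/seteqP; split.
  exact: meets_in_chambers.
have [|||f fJ] := IH; try by case/andP: ujs.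
- by move=> j jj; apply: jS; rewrite /= inE jj orbT.
- by move=> j jj; apply: jT; rewrite /= inE jj orbT.
apply: (meets_in_wall aI _ _ _ ujs fJ).
- by move=> j jj; apply: jS; rewrite /= inE jj orbT.
- by apply: jS; rewrite /= inE eqxx.
- by apply: jT; rewrite /= inE eqxx.
Qed.

(* A convex subcomplex is given by a set [R] of half-spaces [{w | N w t = b}];
   [convex_simplex R x L] says that the simplex with coset [x * G L] lies in it. *)
Definition convex_simplex (R : set (W * bool)) x L :=
  forall t b, R (t, b) -> exists2 v, G L v & N (x * v) t = b.

(** * Reduction to half-spaces containing 1 and walls of simple reflections *)

Section MinimalCoset.
Variables (R : set (W * bool)) (g : W) (js : seq W).
Let J := [set` js].
Hypotheses (JS : J `<=` S) (gJ : convex_simplex R g J).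
Hypothesis jmin : forall x ks, [set` ks] `<=` S -> uniq ks ->
  convex_simplex R x [set` ks] -> size js <= size ks.
Hypothesis ujs : uniq js.

(* Otherwise the projection of [x * G L] onto [g * G J] would be a simplex of the
   convex subcomplex larger than [g * G J]. *)
Lemma minimal_coset_walls x L : L `<=` S -> convex_simplex R x L ->
  forall j, J j -> G L (j ^ (g^-1 * x)).
Proof.
move=> LS xL.
have [u [v [e [Gu Gv Ee em]]]] := dcoset_min_ex cox J L (g^-1 * x).
pose p := u^-1; have Gp : G J p by exact: genV.
have gpe : g * p * e = x * v by rewrite Ee /p !mulgA mulgVK mulgV mul1g.
pose J1 := [set j | J j /\ G L (j ^ e)].
(* If a half-space excludes [g * p], the cosets of [g] and of [x] both reach across its wall. So
   [t ^ (g * p)] lies in [G J] and its conjugate by [e] in [G L]; it belongs to [G J1] and moves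
   [g * p] into the half-space. *)
have gpJ1 : convex_simplex R (g * p) J1.
  move=> t b Rtb; have [E|ne] := eqVneq (N (g * p) t) b.
    by exists 1; [exact: gen1|rewrite mulg1].
  have [w Gw Nw] := gJ Rtb.
  have := sep_diff cox (g * p) (g * w) t; rewrite Nw => E.
  have {}E : N (p^-1 * w) (t ^ (g * p)).
    move: ne E; rewrite invgM -mulgA mulKg.
    by case: (b); case: (N (g * p) t); case: (N _ _).
  have Gr := sep_gen JS (genM (genV Gp) Gw) E.
  have Ngpe : N (g * p * e) t = N (g * p) t.
    by rewrite sepM (negPf (dcoset_min_sep em Gr)) addbF.
  have [w' Gw' Nw'] := xL _ _ Rtb.
  have := sep_diff cox (g * p * e) (x * w') t; rewrite Nw' Ngpe => E'.
  have {}E' : N (v^-1 * w') (t ^ (g * p * e)).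
    move: ne E'; rewrite {1}gpe invgM -mulgA mulKg.
    by case: (b); case: (N (g * p) t); case: (N _ _).
  have Gre := sep_gen LS (genM (genV Gv) Gw') E'.
  exists (t ^ (g * p)).
    by apply: (dcoset_min_cap JS LS em Gr); rewrite -conjgM.
  rewrite -conjgC sep_mull.
    by move: ne; case: (b); case: (N _ _).
  rewrite -(conjgK (g * p) t); apply: reflJ; exact: sep_refl E.
pose ks := [seq j <- js | `[< G L (j ^ e) >]].
have ksJ1 : [set` ks] = J1.
  apply/seteqP; split=> j /=; rewrite mem_filter.
    by move=> /andP[/asboolP].
  by move=> [Jj GLj]; apply/andP; split=> //; exact/asboolP.
have all_js : all (fun j => `[< G L (j ^ e) >]) js.
  rewrite all_count -size_filter eqn_leq size_filter count_size -size_filter.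
  apply: (jmin (x := g * p)); rewrite ?ksJ1//; last exact: filter_uniq.
  by move=> j [/JS].
have GJL w : G J w -> G L (w ^ e).
  by move: w; apply: gen_conj => j /(allP all_js) /asboolP.
move=> j Jj; have Gj : G J (j ^ p) by apply/gen_conjE => //; exact: gen_in.
have -> : g^-1 * x = p * e * v^-1 by rewrite -[p * e](mulKg g) (mulgA g p) gpe mulgA mulgK.
by rewrite conjgM; apply/gen_conjE; [exact: genV | rewrite conjgM; exact: GJL].
Qed.

(** [in_convex] only uses half-spaces containing 1, so [g] is translated to 1 and all such
    half-spaces containing the subcomplex are taken. A half-space of [R] that excludes [g] has its
    wall through the simplex of [g], and the walls of [J] account for it. *)
Definition side_reflections : set W :=
  [set t | forall x L, L `<=` S -> convex_simplex R x L ->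
     exists2 v, G L v & ~~ N (g^-1 * x * v) t].

Lemma convex_simplexE x L : L `<=` S ->
  convex_simplex R x L <-> in_convex side_reflections J (g^-1 * x) L.
Proof.
move=> LS; split=> [xL|[H1 H2] t b Rtb].
  split=> [t|j Jj]; first exact.
  exact: minimal_coset_walls.
have Nx v : N (x * v) t = N g t (+) N (g^-1 * x * v) (t ^ g).
  by rewrite -sepM -mulgA mulVKg.
have [E|ne] := eqVneq (N g t) b.
  have [|v Gv Nv] := H1 (t ^ g).
    move=> y M MS yM; have [v Gv Nv] := yM _ _ Rtb; exists v => //.
    by rewrite -[N _ _](addKb (N g t)) -sepM -mulgA mulVKg Nv E addbb.
  by exists v => //; rewrite Nx (negPf Nv) addbF.
have [w Gw Nw] := gJ Rtb.
have Nwt : N w (t ^ g) by move: ne Nw; rewrite sepM; case: (b); case: (N g t); case: (N w _).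
have Gr := sep_gen JS Gw Nwt.
have Rt : reflection S t by rewrite -(conjgK g t); apply: reflJ; exact: sep_refl Nwt.
have Gt : G L (t ^ x).
  by rewrite -(mulVKg g x) conjgM; move: (t ^ g) Gr; exact: gen_conj.
have [E|ne'] := eqVneq (N x t) b; first by exists 1; [exact: gen1|rewrite mulg1].
exists (t ^ x) => //; rewrite -conjgC sep_mull//.
by move: ne'; case: (b); case: (N x t).
Qed.

Lemma minimal_coset_sides : J `<=` side_reflections.
Proof.
move=> j Jj x L LS xL; have Gj := minimal_coset_walls LS xL Jj.
have [Nj|Nj] := boolP (N (g^-1 * x) j).
  exists (j ^ (g^-1 * x)) => //; rewrite -conjgC sep_mull ?Nj//.
  by apply: refl_simple; exact: JS.
by exists 1; [exact: gen1|rewrite mulg1].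
Qed.

End MinimalCoset.

Theorem convex_intersection a (R : set (W * bool)) : isometry d a ->
  convex_simplex R 1 S -> exists f, [/\ isometry d f,
    forall x L, L `<=` S -> convex_simplex R x L -> G L (d (a x) (f x)) &
    forall x w L, L `<=` S -> G L (d (a x) (f w)) -> convex_simplex R x L].
Proof.
move=> aI R1.
have [fS _ _ _] := cox; have /finite_seqP [s0 SE] := fS.
pose P n := `[< exists x ks, [/\ [set` ks] `<=` S, uniq ks,
  convex_simplex R x [set` ks] & size ks = n] >].
(* The empty simplex has cotype [S] and lies in the subcomplex by [R1]. *)
have exP : exists n, P n.
  have Eu : [set` undup s0] = S.
    by rewrite [RHS]SE; apply/seteqP; split=> j /=; rewrite mem_undup.
  by exists (size (undup s0)); apply/asboolP; exists 1, (undup s0);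
    rewrite Eu; split=> //; exact: undup_uniq.
case: (ex_minnP exP) => n /asboolP [g [js [JS ujs gJ <-]]] nmin.
have jmin x ks : [set` ks] `<=` S -> uniq ks -> convex_simplex R x [set` ks] ->
    size js <= size ks.
  by move=> kS uk xk; apply: nmin; apply/asboolP; exists x, ks.
have [f [fI fin fout]] := meets_in_exists (isometryM g aI) JS
  (minimal_coset_sides JS gJ jmin ujs) ujs.
exists (fun x => f (g^-1 * x)); split=> [|x L LS|x w L LS].
- exact: isometryM.
- by move=> /(convex_simplexE JS gJ jmin ujs x LS) /(fin _ _ LS); rewrite mulVKg.
- move=> H; apply/(convex_simplexE JS gJ jmin ujs x LS); apply: (fout _ (g^-1 * w)) => //.
  by rewrite mulVKg.
Qed.

End Intersection.

(** * Apartments as labelled charts *)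

Lemma gen_set0 (W : groupType) (w : W) : generated_subgroup set0 w -> w = 1.
Proof. by move: w; apply: gen_closed => //; split=> // x y -> ->; rewrite invg1 mulg1. Qed.

Lemma gen_set1 (W : groupType) (s w : W) : s * s = 1 ->
  generated_subgroup [set s] w -> w = 1 \/ w = s.
Proof.
move=> ss; move: w; apply: gen_ind => [_ -> //||_ w -> _ [->|->]]; first by left.
  by rewrite mulg1; right.
by left.
Qed.

Section Charts.
Variables (V : choiceType) (W : groupType) (S : set W).
Hypothesis cox : coxeter_system S.
Local Notation G := generated_subgroup.
Implicit Types (tau : V -> W) (c : W -> {fset V}) (A : {fset V}).

Definition cotype tau A : set W := [set s | S s /\ forall v, v \in A -> tau v <> s].

(* The chambers [c w] form an apartment, labelled by [tau]: the [s]-vertices of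
   [c w] and [c w'] coincide iff [w] and [w'] are in the same coset of [G (S `\ s)]. *)
Record chart tau c : Prop := Chart {
  chart_S : forall w v, v \in c w -> S (tau v);
  chart_inj : forall w u v, u \in c w -> v \in c w -> tau u = tau v -> u = v;
  chart_surj : forall w s, S s -> exists2 v, v \in c w & tau v = s;
  chart_mem : forall w w' v, v \in c w ->
    (v \in c w' <-> G (S `\ tau v) (w^-1 * w')) }.

Definition span c : set {fset V} := [set A | exists w, (A `<=` c w)%fset].

Lemma cotype_S tau A : cotype tau A `<=` S.
Proof. by move=> s []. Qed.

Lemma span_simplicial c : simplicial_complex (span c).
Proof.
split; first by exists 1; exact: fsub0set.
by move=> A B [w Aw] BA; exists w; exact: fsubset_trans BA Aw.
Qed.

Lemma chartM tau c g : chart tau c -> chart tau (fun w => c (g * w)).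
Proof.
move=> cc; split=> [w v|w u v|w s|w w' v].
- by move=> H; apply: (chart_S cc H).
- by move=> H1 H2; apply: (chart_inj cc H1 H2).
- by move=> H; apply: (chart_surj cc (g * w) H).
- by move=> H; have := chart_mem cc (g * w') H; rewrite invgM -mulgA mulKg.
Qed.

Lemma spanM c g : span (fun w => c (g * w)) = span c.
Proof.
apply/seteqP; split=> A [w Aw]; first by exists (g * w).
by exists (g^-1 * w); rewrite mulVKg.
Qed.

Section Chart.
Variables (tau : V -> W) (c : W -> {fset V}).
Hypothesis cc : chart tau c.
Local Notation cot := (cotype tau).

Lemma chart_sub w w' A : (A `<=` c w)%fset ->
  (A `<=` c w')%fset <-> G (cot A) (w^-1 * w').
Proof.
move=> Aw; split=> [Aw'|H]; last first.
  apply/fsubsetP => v vA; apply/(chart_mem cc w' (fsubsetP Aw _ vA)).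
  by apply: gen_sub H => s [Ss sA]; split=> // E; apply: (sA _ vA).
(* The index [None] keeps the family inhabited when [A] is empty. *)
pose J (i : option V) := if i is Some v then S `\ tau v else S.
pose P : set (option V) := [set i | if i is Some v then v \in A else true].
have -> : cot A = \bigcap_(i in P) J i.
  apply/seteqP; split=> s.
    move=> [Ss sA] [v /= vA|//]; split=> // E; exact: sA vA _.
  move=> H; split=> [|v vA E]; first exact: (H None).
  by have [_] := H (Some v) vA; apply.
apply: (gen_bigcap cox); first by exists None.
  by move=> [v|] _ //= s [].
move=> [v|] /= vA; last exact: gen_simple.
apply/(chart_mem cc w' (fsubsetP Aw _ vA)); exact: (fsubsetP Aw').
Qed.

Lemma cotype_chamber w : cot (c w) = set0.
Proof.
apply/seteqP; split=> s // [Ss H]; have [v vw E] := chart_surj cc w Ss.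
by case: (H v vw).
Qed.

Lemma cotype0 : cot fset0 = S.
Proof. by apply/seteqP; split=> s; [case|split=> // v; rewrite inE]. Qed.

Lemma chart_sub_eq w w' : (c w `<=` c w')%fset -> w = w'.
Proof.
move=> /(chart_sub w' (fsubset_refl _)); rewrite cotype_chamber => /gen_set0 H.
by rewrite -[w']mul1g -(mulgV w) -mulgA H mulg1.
Qed.

Lemma cotype_sub w A B : (A `<=` c w)%fset -> (B `<=` c w)%fset ->
  (A `<=` B)%fset <-> cot B `<=` cot A.
Proof.
move=> Aw Bw; split=> [AB s [Ss H]|H].
  by split=> // v /(fsubsetP AB)/H.
apply/fsubsetP => v vA; have vw := fsubsetP Aw _ vA.
have [//|vB] := boolP (v \in B).
have [|_ /(_ v vA)] := H (tau v) => //; split; first exact: chart_S cc _ _ vw.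
by move=> u uB /(chart_inj cc (fsubsetP Bw _ uB) vw) E; rewrite -E uB in vB.
Qed.

Definition face (C : {fset V}) (J : set W) : {fset V} :=
  [fset v in C | ~~ `[< J (tau v) >]]%fset.

Lemma face_sub C J : (face C J `<=` C)%fset.
Proof. by apply/fsubsetP => v; rewrite !inE => /andP[]. Qed.

Lemma face_cotype w J : J `<=` S -> cot (face (c w) J) = J.
Proof.
move=> JS; apply/seteqP; split=> s.
  move=> [Ss H]; have [v vw E] := chart_surj cc w Ss.
  have [//|nJ] := pselect (J s).
  by case: (H v) => //; rewrite !inE vw E; apply/asboolP.
move=> Js; split; first exact: JS.
by move=> v; rewrite !inE => /andP[_ /asboolPn nJ] E; apply: nJ; rewrite E.
Qed.

Lemma panel_card w s : S s -> #|` c w| = (#|` face (c w) [set s]|).+1.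
Proof.
move=> Ss; have [v vw E] := chart_surj cc w Ss.
have -> : face (c w) [set s] = (c w `\ v)%fset.
  apply/fsetP => u; rewrite !inE andbC; case uw: (u \in c w); rewrite ?andbF// !andbT.
  apply/idP/idP => [/asboolPn H|/eqP H].
    by apply/eqP => Eu; apply: H; rewrite Eu.
  by apply/asboolPn => Eu; apply: H; apply: chart_inj cc _ _ _ uw vw _; rewrite Eu.
by rewrite (cardfsD1 v) vw.
Qed.

Lemma chart_panel w w' s : S s -> (face (c w) [set s] `<=` c w')%fset ->
  w' = w \/ w' = w * s.
Proof.
move=> Ss /(chart_sub w' (face_sub _ _)); rewrite face_cotype; last by move=> _ ->.
move=> /(gen_set1 (simple_sq cox Ss)) [] E; [left|right].
  by rewrite -(mulVKg w w') E mulg1.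
by rewrite -(mulVKg w w') E.
Qed.

Lemma chart_adj w s : S s -> (face (c w) [set s] `<=` c (w * s))%fset.
Proof.
move=> Ss; apply/(chart_sub (w * s) (face_sub _ _)).
by rewrite mulKg face_cotype; [exact: gen_in|move=> _ ->].
Qed.

Lemma span_chamber w : chamber (span c) (c w).
Proof.
split=> [|A [w' Aw'] wA]; first by exists w.
have E := chart_sub_eq (fsubset_trans wA Aw').
by apply/eqP; rewrite eqEfsubset wA {1}E Aw'.
Qed.

Lemma chamber_span C : chamber (span c) C -> exists w, C = c w.
Proof. by move=> [[w Cw] Cm]; exists w; rewrite (Cm (c w))//; exists w. Qed.

Lemma span_coxeter : coxeter_complex (span c).
Proof.
split; first exact: span_simplicial.
exists W, S; split=> //; exists (fun A => [set w | (A `<=` c w)%fset]).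
have phiE A w : (A `<=` c w)%fset ->
    [set w' | (A `<=` c w')%fset] = [set w * x | x in G (cot A)].
  move=> Aw; apply/seteqP; split=> w' /=.
    by move=> /(chart_sub w' Aw) H; exists (w^-1 * w') => //; rewrite mulVKg.
  by move=> [x Gx <-]; apply/(chart_sub _ Aw); rewrite mulKg.
have phi_sub A B : span c A -> span c B -> (A `<=` B)%fset <->
    [set w | (B `<=` c w)%fset] `<=` [set w | (A `<=` c w)%fset].
  move=> sA [w Bw]; split=> [AB w' /= Bw'|H]; first exact: fsubset_trans AB Bw'.
  have Aw := H w Bw; apply/(cotype_sub Aw Bw) => s [Ss sB].
  have : (A `<=` c (w * s))%fset.
    by apply: H; apply/(chart_sub _ Bw); rewrite mulKg; apply: gen_in.
  move=> /(chart_sub _ Aw); rewrite mulKg.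
  exact: (gen_simple_mem cox (@cotype_S _ _)).
split=> //; split=> [A [w Aw]|A B|_ [w [J [JS ->]]]].
- by exists w, (cot A); split; [exact: cotype_S|exact: phiE].
- move=> /set_mem sA /set_mem sB E; apply/eqP; rewrite eqEfsubset.
  by apply/andP; split; apply/phi_sub => //; rewrite E.
- exists (face (c w) J); first by exists w; exact: face_sub.
  by rewrite (phiE _ w) ?face_sub// face_cotype.
Qed.

End Chart.

Lemma chart_card2 tau tau' c c' w w' : chart tau c -> chart tau' c' ->
  #|` c w| = #|` c' w'|.
Proof.
suff le tau1 tau2 c1 c2 w1 w2 : chart tau1 c1 -> chart tau2 c2 -> #|` c1 w1| <= #|` c2 w2|.
  by move=> cc cc'; apply/eqP; rewrite eqn_leq (le tau tau')// (le tau' tau).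
move=> cc1 cc2.
have <- : #|` [fset tau1 v | v in c1 w1]%fset| = #|` c1 w1|.
  by apply: card_in_imfset => u v /= ux vx; exact: (chart_inj cc1 ux vx).
apply: (@leq_trans #|` [fset tau2 v | v in c2 w2]%fset|); last exact: leq_imfset_card.
apply/fsubset_leq_card/fsubsetP => s /imfsetP[v /= v1 ->].
have [u u2 <-] := chart_surj cc2 w2 (chart_S cc1 v1); exact: in_imfset.
Qed.

(** Along a gallery the next chamber is the only other one on its panel, and its new vertex takes
    the only label left. *)
Lemma chart_rigid tau tau' c c' : chart tau c -> chart tau' c' -> span c = span c' ->
  c 1 = c' 1 -> {in c 1, tau =1 tau'} ->
  forall w, c w = c' w /\ {in c w, tau =1 tau'}.
Proof.
move=> cc cc' E E1 T1 w; elim/(@len_ind_r _ _ cox): w => [//|s w Ss _ [Ew Tw]].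
have Ews : c (w * s) = c' (w * s).
  have := span_chamber cc' (w * s); rewrite -E => /(chamber_span) [x Ex].
  have : (face tau (c w) [set s] `<=` c x)%fset.
    rewrite -Ex; apply: fsubset_trans (chart_adj cc' w Ss).
    rewrite -Ew; apply/fsubsetP => v; rewrite !inE => /andP[vw].
    by rewrite Tw// vw.
  move=> /(chart_panel cc Ss) [] Exw; last by rewrite Ex Exw.
  have : c' (w * s) = c' w by rewrite Ex Exw Ew.
  move=> Ec; have := chart_sub_eq cc' (w := w * s) (w' := w).
  rewrite Ec fsubset_refl => /(_ isT) /(congr1 ( *%g w^-1)).
  by rewrite mulKg mulVg => /(simple_neq1 cox Ss).
split=> // v vws.
have inP t b : chart t b -> v \in b (w * s) -> t v <> s -> v \in b w.
  move=> cb vb ts; apply/(chart_mem cb _ vb); rewrite invgM mulgVK.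
  by apply: genV; apply: gen_in; split=> // /esym.
have vws' : v \in c' (w * s) by rewrite -Ews.
have [vw|vw] := boolP (v \in c w); first exact: Tw.
have -> : tau v = s.
  by have [//|ne] := pselect (tau v = s); rewrite (inP _ _ cc vws ne) in vw.
have [//|ne] := pselect (s = tau' v).
by rewrite Ew (inP _ _ cc' vws' (nesym ne)) in vw.
Qed.

End Charts.

Section CoxeterChart.
Variables (V : choiceType) (X : set {fset V}) (W : groupType) (S : set W).
Variable phi : {fset V} -> set W.
Hypotheses (Xs : simplicial_complex X) (cox : coxeter_system S).
Hypothesis phi_bij : set_bij X (standard_cosets S) phi.
Hypothesis phi_sub : forall A B, X A -> X B -> ((A `<=` B)%fset <-> phi B `<=` phi A).
Local Notation G := generated_subgroup.

(** The cotype of [A], read off from the coset [phi A] at [w] before vertices have labels. *)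
Let link A w : set W := [set s | S s /\ phi A (w * s)].

Let linkP A w : X A -> phi A w -> forall y, phi A y <-> G (link A w) (w^-1 * y).
Proof.
move=> XA; have [fun_phi _ _] := phi_bij; have [x [J [JS phiE]]] := fun_phi _ XA.
have phiJ z : phi A z <-> G J (x^-1 * z).
  rewrite phiE; split=> [[u Gu <-]|H]; first by rewrite mulKg.
  by exists (x^-1 * z) => //; rewrite mulVKg.
move=> /phiJ Gw y.
have wJ z : phi A z <-> G J (w^-1 * z).
  rewrite phiJ -(genMl _ (genV Gw)); apply: iff_sym.
  by rewrite invgM invgK -mulgA mulVKg.
suff -> : link A w = J by [].
apply/seteqP; split=> s; first by move=> [Ss /wJ]; rewrite mulKg;
  exact: (gen_simple_mem cox JS).
by move=> Js; split; [exact: JS|apply/wJ; rewrite mulKg; exact: gen_in].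
Qed.

Let chamber_of : exists c : W -> {fset V}, forall w, X (c w) /\ phi (c w) = [set w].
Proof.
suff H w : exists C, X C /\ phi C = [set w] by have [c Hc] := choice H; exists c.
have [_ _ surj_phi] := phi_bij.
have [|A XA EA] := surj_phi [set w]; last by exists A.
exists w, set0; split=> //; apply/seteqP; split=> y.
  by move=> ->; exists 1; [exact: gen1|rewrite mulg1].
by move=> [x /gen_set0 -> <-]; rewrite mulg1.
Qed.

(** A vertex [v] of [c w] is labelled by the [s] whose singleton is the link of the opposite panel.
    The link of [v] itself is then [S] without [s] and is the same at all chambers containing [v],
    so the label does not depend on [w]. *)
Lemma coxeter_chart : exists tau c, chart S tau c /\ X = span c.
Proof.
have [c cP] := chamber_of.
have Xc w : X (c w) by case: (cP w).
have sub_c A w : X A -> (A `<=` c w)%fset <-> phi A w.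
  move=> XA; apply: (iff_trans (phi_sub XA (Xc w))).
  by case: (cP w) => _ ->; split=> [|? _ ->//]; apply.
have X_sub A w : (A `<=` c w)%fset -> X A by apply: (proj2 Xs).
have link_ex w J : J `<=` S -> exists2 A, (A `<=` c w)%fset & link A w = J.
  move=> JS; have [_ _ surj_phi] := phi_bij.
  have [A XA EA] : exists2 A, X A & phi A = [set w * x | x in G J].
    by apply: surj_phi; exists w, J; split; [exact: JS|].
  exists A; first by apply/(sub_c _ _ XA); rewrite EA; exists 1; [exact: gen1|rewrite mulg1].
  apply/seteqP; split=> s.
    by move=> [Ss]; rewrite EA => -[x Gx /mulgI E];
      apply: (gen_simple_mem cox JS Ss); rewrite -E.
  by move=> Js; split; [exact: JS|rewrite EA; exists s => //; exact: gen_in].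
have link_sub w A B : (A `<=` c w)%fset -> (B `<=` c w)%fset ->
    (A `<=` B)%fset <-> link B w `<=` link A w.
  move=> Aw Bw; have XA := X_sub _ _ Aw; have XB := X_sub _ _ Bw.
  split=> [/(phi_sub XA XB) H s [Ss /H]//|H]; apply/(phi_sub XA XB) => y.
  have Pw := proj1 (sub_c _ _ XA) Aw; have Qw := proj1 (sub_c _ _ XB) Bw.
  move=> /(linkP XB Qw) Gy; apply/(linkP XA Pw); exact: gen_sub Gy.
have link_c w : link (c w) w = set0.
  apply/seteqP; split=> s // [Ss]; case: (cP w) => _ -> /= /(congr1 ( *%g w^-1)).
  by rewrite mulKg mulVg => /(simple_neq1 cox Ss).
have link_eq w A B : (A `<=` c w)%fset -> (B `<=` c w)%fset -> link A w = link B w -> A = B.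
  move=> Aw Bw E; apply/eqP; rewrite eqEfsubset.
  by apply/andP; split; apply/(link_sub w) => //; rewrite E.
have del_sub w v : (c w `\ v `<=` c w)%fset by exact: fsubD1set.
have del_in w v A : (A `<=` c w)%fset -> v \notin A -> (A `<=` c w `\ v)%fset.
  by move=> Aw vA; rewrite fsubsetD1 Aw.
have link_del w v : v \in c w -> exists2 s, S s & link (c w `\ v)%fset w = [set s].
  move=> vw; have [s ls] : exists s, link (c w `\ v)%fset w s.
    apply: contrapT => /forallNP H.
    have E : (c w `\ v)%fset = c w.
      apply: (link_eq w) => //; rewrite link_c.
      by apply/seteqP; split=> s // /H.
    by move: vw; rewrite -E !inE eqxx.
  have [Ss _] := ls; exists s => //.
  have [|B Bw EB] := link_ex w [set s]; first by move=> _ ->.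
  rewrite -EB; congr (link _ w); apply/eqP; rewrite eqEfsubset.
  have PB : (c w `\ v `<=` B)%fset by apply/(link_sub w) => //; rewrite EB => _ ->.
  rewrite PB del_in//; apply/negP => vB.
  have E : B = c w.
    apply/eqP; rewrite eqEfsubset Bw; apply/fsubsetP => u uw.
    have [->//|uv] := eqVneq u v; apply: (fsubsetP PB).
    by rewrite !inE uv.
  have : link B w s by rewrite EB.
  by rewrite E link_c.
have del_link w s : S s -> exists2 v, v \in c w & link (c w `\ v)%fset w = [set s].
  move=> Ss; have [|B Bw EB] := link_ex w [set s]; first by move=> _ ->.
  have [v vw vB] : exists2 v, v \in c w & v \notin B.
    apply: contrapT => H; have E : B = c w.
      apply/eqP; rewrite eqEfsubset Bw; apply/fsubsetP => u uw.
      by apply: contrapT => /negP uB; apply: H; exists u.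
    have : link B w s by rewrite EB.
    by rewrite E link_c.
  exists v => //; have [r Sr Er] := link_del w v vw.
  have : link (c w `\ v)%fset w `<=` [set s].
    by rewrite -EB; apply/(link_sub w) => //; exact: del_in.
  by rewrite Er => /(_ r erefl) ->.
have link1 w v s : v \in c w -> link (c w `\ v)%fset w = [set s] ->
    link [fset v]%fset w = S `\ s.
  move=> vw Es; have v1 : ([fset v] `<=` c w)%fset by rewrite fsub1set.
  apply/seteqP; split=> r [Sr Hr]; split=> //.
    move=> Er; have : ([fset v] `<=` c w `\ v)%fset.
      by apply/(link_sub w) => //; rewrite Es => _ ->; rewrite -Er.
    by rewrite fsub1set !inE eqxx.
  have [u uw Eu] := del_link w r Sr.
  have uv : u != v by apply/eqP => E;
    apply: Hr; move: Es; rewrite -E Eu => /seteqP[/(_ r erefl)].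
  have : link [fset v]%fset w r.
    have : ([fset v] `<=` c w `\ u)%fset by rewrite fsub1set !inE eq_sym uv.
    by move=> /(link_sub w _ _ v1 (del_sub _ _)); rewrite Eu; apply.
  by case.
have linkT v w w' : v \in c w -> v \in c w' -> link [fset v]%fset w = link [fset v]%fset w'.
  rewrite -!fsub1set => vw vw'; have Xv := X_sub _ _ vw.
  have P := proj1 (sub_c _ _ Xv) vw; have P' := proj1 (sub_c _ _ Xv) vw'.
  have Gww' := proj1 (linkP Xv P _) P'.
  apply/seteqP; split=> s [Ss Hs]; split=> //; apply/(linkP Xv P).
    move/(linkP Xv P): Hs; rewrite mulKg => Gs.
    by rewrite mulgA; exact: genM.
  move/(linkP Xv P): Hs; rewrite mulgA => Gs.
  by rewrite mulKg -(genMl _ Gww').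
have [tau tauP] : exists tau : V -> W, forall v w, v \in c w ->
    S (tau v) /\ link (c w `\ v)%fset w = [set tau v].
  suff H v : exists t, forall w, v \in c w -> S t /\ link (c w `\ v)%fset w = [set t].
    by have [t Ht] := choice H; exists t.
  have [[w0 vw0]|H] := pselect (exists w, v \in c w); last first.
    by exists 1 => w vw; case: H; exists w.
  have [s Ss Es] := link_del w0 v vw0; exists s => w vw; split=> //.
  have [r Sr Er] := link_del w v vw; rewrite Er.
  have := linkT v w w0 vw vw0; rewrite (link1 _ _ _ vw Er) (link1 _ _ _ vw0 Es) => /seteqP[H _].
  have [->//|ne] := pselect (s = r).
  by have [|_ []] := H s; first by split.
exists tau, c; split; last first.
  apply/seteqP; split=> A; last by move=> [w /X_sub].
  move=> XA; have [fun_phi _ _] := phi_bij; have [w [J [JS phiE]]] := fun_phi _ XA.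
  exists w; apply/(sub_c _ _ XA); rewrite phiE; exists 1; [exact: gen1|exact: mulg1].
split=> [w v /tauP[]//|w u v uw vw Euv|w s Ss|w w' v vw].
- have [_ Eu] := tauP _ _ uw; have [_ Ev] := tauP _ _ vw; rewrite Euv -Ev in Eu.
  have E := link_eq _ _ _ (del_sub _ _) (del_sub _ _) Eu.
  apply/eqP; apply: contraT => uv; have : u \in (c w `\ v)%fset by rewrite !inE uv.
  by rewrite -E !inE eqxx.
- have [v vw Ev] := del_link w s Ss; exists v => //.
  by have [_] := tauP _ _ vw; rewrite Ev => /seteqP[/(_ s erefl) ->].
- have [_ Ev] := tauP _ _ vw; rewrite -(link1 _ _ _ vw Ev).
  have v1 : ([fset v] `<=` c w)%fset by rewrite fsub1set.
  have Xv := X_sub _ _ v1; have Pv := proj1 (sub_c _ _ Xv) v1.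
  rewrite -fsub1set; apply: (iff_trans (sub_c _ w' Xv)); exact: linkP.
Qed.

End CoxeterChart.

(** * Labelling a building *)

Section Labelling.
Variables (V : choiceType) (W : groupType) (S : set W).
Hypothesis cox : coxeter_system S.
Local Notation G := generated_subgroup.
Local Notation chart := (chart S).
Local Notation cotype := (cotype S).

Lemma imfset_fixed (f : V -> V) (A : {fset V}) : {in A, forall v, f v = v} -> (f @` A)%fset = A.
Proof.
move=> fA; apply/fsetP => v; apply/imfsetP/idP => [[u /= uA ->]|vA]; first by rewrite fA.
by exists v => //; rewrite fA.
Qed.

Lemma iso_chart (tau : V -> W) (c : W -> {fset V}) Y (f : V -> V) :
  chart tau c -> complex_isomorphism (span c) Y f ->
  exists tau', [/\ chart tau' (fun w => (f @` c w)%fset),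
    Y = span (fun w => (f @` c w)%fset) & forall w u, u \in c w -> tau' (f u) = tau u].
Proof.
move=> cc [finj fY].
have {}finj w w' u v : u \in c w -> v \in c w' -> f u = f v -> u = v.
  by move=> uw vw; apply: finj; [exists w|exists w']; rewrite fsub1set.
have [tau' tau'P] : exists tau' : V -> W, forall w u, u \in c w -> tau' (f u) = tau u.
  suff H x : exists t, forall w u, u \in c w -> f u = x -> t = tau u.
    by have [t Ht] := choice H; exists t => w u uw; exact: Ht uw _.
  have [[w [u [uw <-]]]|H] := pselect (exists w u, u \in c w /\ f u = x).
    by exists (tau u) => w' u' uw' /esym /(finj _ _ _ _ uw uw') ->.
  by exists 1 => w u uw fu; case: H; exists w, u.
exists tau'; split=> //.
  split=> [w _ /imfsetP[v /= vw ->]|w _ _ /imfsetP[u /= uw ->] /imfsetP[v /= vw ->]|w s Ss|].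
  - by rewrite (tau'P _ _ vw); exact: (chart_S cc vw).
  - by rewrite (tau'P _ _ vw) (tau'P _ _ uw) => /(chart_inj cc uw vw) ->.
  - have [v vw Ev] := chart_surj cc w Ss; exists (f v); first exact: in_imfset.
    by rewrite (tau'P _ _ vw).
  - move=> w w' _ /imfsetP[v /= vw ->]; rewrite (tau'P _ _ vw) -(chart_mem cc _ vw).
    split=> [/imfsetP[u /= uw' /(finj _ _ _ _ vw uw') ->]//|]; exact: in_imfset.
rewrite -fY; apply/seteqP; split=> B.
  move=> [A [w Aw] <-]; exists w; apply/fsubsetP => _ /imfsetP[v /= vA ->].
  by apply: in_imfset; exact: (fsubsetP Aw).
move=> [w Bw]; exists [fset v in c w | f v \in B]%fset.
  by exists w; apply/fsubsetP => v; rewrite !inE => /andP[].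
apply/fsetP => x; apply/imfsetP/idP => [[v /=]|xB].
  by rewrite !inE => /andP[_ fv ->].
have /imfsetP[v /= vw Ex] := fsubsetP Bw _ xB.
by exists v => //; rewrite !inE vw -Ex.
Qed.

Variables (Delta : set {fset V}) (Apts : set (set {fset V})).
Hypothesis DA : apartment_system Delta Apts.

Let apt_iso X Y A B : Apts X -> Apts Y -> X A -> X B -> Y A -> Y B ->
  exists f, complex_isomorphism X Y f /\ forall v, v \in (A `|` B)%fset -> f v = v.
Proof. by case: DA => _ _ _; apply. Qed.

Let apt_ex A B : Delta A -> Delta B -> exists X, [/\ Apts X, X A & X B].
Proof. by case: DA => _ _ H _; exact: H. Qed.

Let apt_sub X : Apts X -> X `<=` Delta.
Proof. by case: DA => H _ _ _ /H []. Qed.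

Section Base.
Variables (tau0 : V -> W) (c0 : W -> {fset V}).
Hypotheses (cc0 : chart tau0 c0) (A0 : Apts (span c0)).

Let based X c tau := [/\ chart tau c, X = span c, c 1 = c0 1 & {in c0 1, tau =1 tau0}].

Let based_ex X : Apts X -> X (c0 1) -> exists c tau, based X c tau.
Proof.
move=> AX Xc; have S0 : span c0 (c0 1) by exists 1.
have [f [fiso ff]] := apt_iso A0 AX S0 S0 Xc Xc.
have {}ff : {in c0 1, forall v, f v = v} by move=> v vc; apply: ff; rewrite inE vc.
have [tau [ct EX Et]] := iso_chart cc0 fiso.
exists (fun w => (f @` c0 w)%fset), tau; split=> //; first exact: imfset_fixed.
by move=> v vc; rewrite -(ff v vc) (Et _ _ vc) ff.
Qed.

Let based_unique X Y c c' tau tau' v w w' : Apts X -> Apts Y -> based X c tau ->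
  based Y c' tau' -> v \in c w -> v \in c' w' -> tau v = tau' v.
Proof.
move=> AX AY [cc EX E1 T1] [cc' EY E1' T1'] vw vw'.
have Xc : X (c0 1) by rewrite EX -E1; exists 1.
have Yc : Y (c0 1) by rewrite EY -E1'; exists 1.
have Xv : X [fset v]%fset by rewrite EX; exists w; rewrite fsub1set.
have Yv : Y [fset v]%fset by rewrite EY; exists w'; rewrite fsub1set.
have [g [giso gf]] := apt_iso AX AY Xc Xv Yc Yv.
rewrite EX in giso; have [tau1 [c1 EY' Et]] := iso_chart cc giso.
have g1 : {in c0 1, forall v, g v = v} by move=> u uc; apply: gf; rewrite !inE uc.
have gv : g v = v by apply: gf; rewrite !inE eqxx orbT.
have Ec : (g @` c 1)%fset = c' 1 by rewrite E1 E1' imfset_fixed.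
have Tc : {in (g @` c 1)%fset, tau1 =1 tau'}.
  move=> _ /imfsetP[u /= uc ->]; rewrite (Et _ _ uc); rewrite E1 in uc.
  by rewrite g1// T1// T1'.
have := chart_rigid cox c1 cc' (etrans (esym EY') EY) Ec Tc w.
move=> [_ /(_ v)]; rewrite -(Et _ _ vw) gv; apply.
by rewrite -gv; exact: in_imfset.
Qed.

(** Apartments through [c0 1] inherit its labels consistently by rigidity, which defines [tau]. Any
    other apartment gets its labels from one of these across a common chamber, and they are compared
    with [tau] along galleries. *)
Lemma labelling_base : exists tau, forall X, Apts X -> exists c, chart tau c /\ X = span c.
Proof.
have [tau tauP] : exists tau : V -> W, forall X c t, Apts X -> based X c t ->
    forall w v, v \in c w -> t v = tau v.
  suff H v : exists s, forall X c t, Apts X -> based X c t -> forall w, v \in c w -> t v = s.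
    by have [t Ht] := choice H; exists t => X c t' AX bX w v; exact: (Ht v _ _ _ AX bX).
  have [[X [c [t [w [AX bX vw]]]]]|H] := pselect (exists X c t w,
      [/\ Apts X, based X c t & v \in c w]).
    by exists (t v) => Y c' t' AY bY w' vw'; exact: based_unique bY bX vw' vw.
  by exists 1 => X c t AX bX w vw; case: H; exists X, c, t, w.
have chart_tau X c t : Apts X -> based X c t -> chart tau c.
  move=> AX bX; have [cc _ _ _] := bX; have E := tauP _ _ _ AX bX.
  split=> [w v vw|w u v uw vw|w s Ss|w w' v vw].
  - by rewrite -(E _ _ vw); exact: (chart_S cc vw).
  - by rewrite -(E _ _ uw) -(E _ _ vw); exact: (chart_inj cc uw vw).
  - by have [v vw Ev] := chart_surj cc w Ss; exists v => //; rewrite -(E _ _ vw).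
  - by rewrite -(E _ _ vw); exact: (chart_mem cc).
have Dc0 : Delta (c0 1) by apply: (apt_sub A0); exists 1.
have chart_thru t' c' w : chart t' c' -> Delta (c' w) -> exists X c x,
    [/\ Apts X, chart tau c, X = span c & c x = c' w].
  move=> cc' Dw; have [X [AX X0 Xw]] := apt_ex Dc0 Dw.
  have [c [t bX]] := based_ex AX X0; have cc := chart_tau _ _ _ AX bX.
  have [_ EX _ _] := bX; rewrite EX in Xw; have [x wx] := Xw.
  exists X, c, x; split=> //; apply/eqP; rewrite eq_sym eqEfcard wx.
  by rewrite (chart_card2 w x cc' cc) leqnn.
exists tau => X AX.
have [_ coxX _ _] := DA.
have X0 : X fset0 by have [[]] := coxX _ AX.
have S0 : span c0 fset0 by exists 1; exact: fsub0set.
have [h [hiso _]] := apt_iso A0 AX S0 S0 X0 X0.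
have [t' [cc' EX _]] := iso_chart cc0 hiso.
have XD : X (h @` c0 1)%fset by rewrite EX; exists 1.
have [Y [c2 [x [AY cc2 EY Ex]]]] := chart_thru _ _ 1 cc' (apt_sub AX XD).
have YD : Y (h @` c0 1)%fset by rewrite EY -Ex; exists x.
have [g [giso gf]] := apt_iso AY AX YD YD XD XD.
have {}gf : {in c2 x, forall v, g v = v} by move=> v; rewrite Ex => vD;
  apply: gf; rewrite inE vD.
rewrite EY in giso; have [t3 [cc3 EX3 Et3]] := iso_chart cc2 giso.
exists (fun w => (g @` c2 w)%fset); split=> //.
set c3 := fun w => _ in cc3 EX3 *.
have XD3 w : Delta (c3 w) by apply: (apt_sub AX); rewrite EX3; exists w.
suff E w : {in c3 w, t3 =1 tau}.
  split=> [w v vw|w u v uw vw|w s Ss|w w' v vw].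
  - by rewrite -(E _ _ vw); exact: (chart_S cc3 vw).
  - by rewrite -(E _ _ uw) -(E _ _ vw); exact: (chart_inj cc3 uw vw).
  - by have [v vw Ev] := chart_surj cc3 w Ss; exists v => //; rewrite -(E _ _ vw).
  - by rewrite -(E _ _ vw); exact: (chart_mem cc3).
rewrite -(mulVKg x w); elim/(@len_ind_r _ _ cox): (x^-1 * w) => [|s u Ss _ IH].
  by rewrite mulg1 => v /imfsetP[z /= zx ->]; rewrite (Et3 _ _ zx) gf.
(* Some apartment through [c0 1] contains this chamber, so [tau] is injective on it; agreement on
   the vertices shared with the previous chamber leaves one label for the last vertex. *)
move=> v vs; have [Z [c4 [y [_ cc4 _ Ey]]]] := chart_thru _ _ (x * (u * s)) cc3 (XD3 _).
have vy := vs; rewrite -Ey in vy.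
have near z : z \in c3 (x * (u * s)) -> t3 z <> s -> z \in c3 (x * u).
  move=> zs ne; apply/(chart_mem cc3 _ zs).
  have -> : (x * (u * s))^-1 * (x * u) = s^-1 by rewrite (mulgA x) invgM mulgVK.
  by apply: genV; apply: gen_in; split=> // /esym.
have [Ev|ne] := pselect (t3 v = s); last exact: IH (near _ vs ne).
have [//|ne] := pselect (t3 v = tau v).
have Sv := chart_S cc4 vy.
have [z zs Ez] := chart_surj cc3 (x * (u * s)) Sv.
have ts : t3 z <> s by rewrite Ez => E; apply: ne; rewrite E.
have Ez' := IH _ (near _ zs ts); rewrite Ez in Ez'.
have zy := zs; rewrite -Ey in zy.
by have E := chart_inj cc4 vy zy Ez'; rewrite E Ez in ne.
Qed.

End Base.

End Labelling.

(** * The Weyl distance of a building *)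

Section ChartIso.
Variables (V : choiceType) (W : groupType) (S : set W).
Variables (tau : V -> W) (c c' : W -> {fset V}).
Hypotheses (cc : chart S tau c) (cc' : chart S tau c').

Lemma chart_iso : exists h, complex_isomorphism (span c) (span c') h /\
  forall z v, v \in c z -> v \in c' z -> h v = v.
Proof.
have [h hP] : exists h : V -> V, forall v z, v \in c z -> h v \in c' z /\ tau (h v) = tau v.
  suff H v : exists u, forall z, v \in c z -> u \in c' z /\ tau u = tau v.
    by have [h Hh] := choice H; exists h.
  have [[z0 vz0]|H] := pselect (exists z, v \in c z); last first.
    by exists v => z vz; case: H; exists z.
  have [u uz0 Eu] := chart_surj cc' z0 (chart_S cc vz0).
  exists u => z vz; split=> //; apply/(chart_mem cc' _ uz0); rewrite Eu.
  by apply/(chart_mem cc _ vz0).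
exists h; split; last first.
  by move=> z v vz vz'; have [hz Eh] := hP _ _ vz; exact: (chart_inj cc' hz vz' Eh).
split=> [u v [z1]|].
  rewrite fsub1set => uz1 [z2]; rewrite fsub1set => vz2 E.
  have [hu Eu] := hP _ _ uz1; have [hv Ev] := hP _ _ vz2.
  have uz2 : u \in c z2.
    apply/(chart_mem cc _ uz1); rewrite -Eu; apply/(chart_mem cc' _ hu).
    by rewrite E.
  by apply: (chart_inj cc uz2 vz2); rewrite -Eu -Ev E.
apply/seteqP; split=> B.
  move=> [A [w Aw] <-]; exists w; apply/fsubsetP => _ /imfsetP[v /= vA ->].
  by have [] := hP _ _ (fsubsetP Aw _ vA).
move=> [w Bw]; exists [fset v in c w | h v \in B]%fset.
  by exists w; apply/fsubsetP => v; rewrite !inE => /andP[].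
apply/fsetP => x; apply/imfsetP/idP => [[v /=]|xB].
  by rewrite !inE => /andP[_ hv ->].
have xw := fsubsetP Bw _ xB; have [v vw Ev] := chart_surj cc w (chart_S cc' xw).
have [hv Eh] := hP _ _ vw; have E : x = h v by apply: (chart_inj cc' xw hv); rewrite Eh.
by exists v => //; rewrite !inE vw -E.
Qed.

End ChartIso.

Section BuildingDistance.
Variables (V : choiceType) (W : groupType) (S : set W).
Hypothesis cox : coxeter_system S.
Local Notation G := generated_subgroup.
Local Notation chart := (chart S).
Local Notation cotype := (cotype S).
Local Notation len := (len cox).
Variables (Delta : set {fset V}) (Apts : set (set {fset V})) (tau : V -> W).
Hypothesis DA : apartment_system Delta Apts.
Hypothesis Ds : simplicial_complex Delta.
Hypothesis lab : forall X, Apts X -> exists c, chart tau c /\ X = span c.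

Let apt_sub X : Apts X -> X `<=` Delta.
Proof. by case: DA => H _ _ _ /H []. Qed.

Definition apt_chart c := chart tau c /\ Apts (span c).

Lemma apt_chartM c g : apt_chart c -> apt_chart (fun w => c (g * w)).
Proof. by move=> [cc Ac]; split; [exact: chartM | rewrite spanM]. Qed.

Lemma apt_chart_chamber c w : apt_chart c -> chamber Delta (c w).
Proof.
move=> [cc Ac]; have Dc : Delta (c w) by apply: (apt_sub Ac); exists w.
split=> // A DA' wA; have [_ _ H _] := DA.
have [X [AX XA _]] := H _ _ DA' DA'.
have [c' [cc' EX]] := lab AX; rewrite EX in XA; have [x Ax] := XA.
have Ec : c w = c' x.
  apply/eqP; rewrite eqEfcard (fsubset_trans wA Ax).
  by rewrite (chart_card2 w x cc cc') leqnn.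
by apply/eqP; rewrite eqEfsubset wA Ec Ax.
Qed.

Lemma apt_chart_pair C D : chamber Delta C -> chamber Delta D ->
  exists c w, [/\ apt_chart c, c 1 = C & c w = D].
Proof.
move=> [DC Cm] [DD Dm]; have [_ _ H _] := DA.
have [X [AX XC XD]] := H _ _ DC DD.
have [c [cc EX]] := lab AX; rewrite EX in AX XC XD.
have [x Cx] := XC; have [y Dy] := XD.
exists (fun w => c (x * w)), (x^-1 * y); split; first exact: apt_chartM.
  by rewrite mulg1; apply: Cm => //; apply: (apt_sub AX); exists x.
by rewrite mulVKg; apply: Dm => //; apply: (apt_sub AX); exists y.
Qed.

(** An isomorphism fixing the common chamber and [P] preserves coordinates by rigidity. *)
Lemma apt_chart_transport c c' w w' P : apt_chart c -> apt_chart c' -> c 1 = c' 1 ->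
  (P `<=` c w)%fset -> (P `<=` c' w')%fset -> (P `<=` c' w)%fset.
Proof.
move=> [cc Ac] [cc' Ac'] E1 Pw Pw'; have [_ _ _ H] := DA.
have [|||| g [giso gf]] := H _ _ (c 1) P Ac Ac';
  try by [exists 1|exists w|exists w'|exists 1; rewrite E1].
have gc : {in c 1, forall v, g v = v} by move=> v vc; apply: gf; rewrite !inE vc.
have gP : {in P, forall v, g v = v} by move=> v vc; apply: gf; rewrite !inE vc orbT.
have [t [c1 Es Et]] := iso_chart cc giso.
have Ec : (g @` c 1)%fset = c' 1 by rewrite imfset_fixed.
have Tc : {in (g @` c 1)%fset, t =1 tau}.
  by rewrite imfset_fixed// => v vc; rewrite -{1}(gc _ vc) (Et _ _ vc).
have [Ew _] := chart_rigid cox c1 cc' (esym Es) Ec Tc w.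
by rewrite -Ew -(imfset_fixed gP); apply/fsubsetP => _ /imfsetP[v /= vP ->];
  apply: in_imfset; exact: (fsubsetP Pw).
Qed.

Definition building_chamber := {C : {fset V} | chamber Delta C}.
Local Notation Ch := building_chamber.

Lemma weyl_distance_ex : exists d : Ch -> Ch -> W, forall C D c x y,
  apt_chart c -> c x = sval C -> c y = sval D -> d C D = x^-1 * y.
Proof.
suff H (p : Ch * Ch) : exists w, forall c x y,
    apt_chart c -> c x = sval p.1 -> c y = sval p.2 -> w = x^-1 * y.
  by have [f Hf] := choice H; exists (fun C D => f (C, D)) => C D; exact: (Hf (C, D)).
case: p => [[C Cc] [D Dc]] /=; have [c [w [ac c1 cw]]] := apt_chart_pair Cc Dc.
exists w => c' x y ac' c'x c'y.
have ac2 := apt_chartM x ac'.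
have /= := apt_chart_transport (w := w) (w' := x^-1 * y) (P := D) ac ac2.
rewrite mulg1 c1 c'x mulVKg cw c'y => /(_ erefl (fsubset_refl _) (fsubset_refl _)).
by rewrite -c'y => /(chart_sub_eq cox (proj1 ac')) ->; rewrite mulKg.
Qed.

Variable d : Ch -> Ch -> W.
Hypothesis dP : forall C D c x y,
  apt_chart c -> c x = sval C -> c y = sval D -> d C D = x^-1 * y.

Lemma chamber_inj (C D : Ch) : sval C = sval D -> C = D.
Proof. by case: C D => [C Cc] [D Dc] /= E; exact: eq_exist. Qed.

Lemma face_d (C D : Ch) P : (P `<=` sval C)%fset ->
  (P `<=` sval D)%fset <-> G (cotype tau P) (d C D).
Proof.
move=> PC; have [c [w [ac c1 cw]]] := apt_chart_pair (svalP C) (svalP D).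
rewrite (dP ac c1 cw) -cw; rewrite -c1 in PC; exact: (chart_sub cox (proj1 ac)).
Qed.

Lemma d_face (C D : Ch) s : S s ->
  (face tau (sval C) [set s] `<=` sval D)%fset <-> (C = D \/ d C D = s).
Proof.
move=> Ss; have [c [w [ac c1 cw]]] := apt_chart_pair (svalP C) (svalP D).
have [cc _] := ac; rewrite (dP ac c1 cw) invg1 mul1g -c1 -cw; split.
  move=> /(chart_panel cox cc Ss); rewrite mul1g => -[Ew|->]; last by right.
  by left; apply: chamber_inj; rewrite -c1 -cw Ew.
move=> [ECD|->]; last by have := chart_adj cox cc 1 Ss; rewrite mul1g.
by rewrite cw -ECD -c1; exact: face_sub.
Qed.

Lemma d_weak s C D E : S s -> d D E = s -> d C E = d C D \/ d C E = d C D * s.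
Proof.
move=> Ss dDE; have PE : (face tau (sval D) [set s] `<=` sval E)%fset.
  by apply/(d_face D E Ss); right.
have [c [w [ac c1 cw]]] := apt_chart_pair (svalP C) (svalP D).
have [c' [w' [ac' c1' cw']]] := apt_chart_pair (svalP C) (svalP E).
rewrite (dP ac c1 cw) (dP ac' c1' cw') !invg1 !mul1g.
rewrite -cw' in PE.
have [cc _] := ac'.
have PD : (face tau (sval D) [set s] `<=` c w)%fset by rewrite cw; exact: face_sub.
have c1c1' : c 1 = c' 1 by rewrite c1.
have Pw := apt_chart_transport ac ac' c1c1' PD PE.
have Pcot : cotype tau (face tau (sval D) [set s]) = [set s].
  by rewrite -cw face_cotype; [|exact: (proj1 ac)|move=> _ ->].
have := proj1 (chart_sub cox cc w' Pw) PE; rewrite Pcot => /(gen_set1 (simple_sq cox Ss)) [] H.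
  by left; rewrite -(mulVKg w w') H mulg1.
by right; rewrite -(mulVKg w w') H.
Qed.

Lemma d_sym C D : d D C = (d C D)^-1.
Proof.
have [c [w [ac c1 cw]]] := apt_chart_pair (svalP C) (svalP D).
by rewrite (dP ac c1 cw) (dP ac cw c1) invgM invgK.
Qed.

Lemma d_eq C D : d C D = 1 <-> C = D.
Proof.
have [c [w [ac c1 cw]]] := apt_chart_pair (svalP C) (svalP D).
split=> [|E]; last by rewrite (dP ac c1 (y := 1)) ?mulg1 ?invg1// -E.
by rewrite (dP ac c1 cw) invg1 mul1g => E; apply: chamber_inj; rewrite -c1 -cw E.
Qed.

Lemma d_ex s C D : S s -> exists E, d D E = s /\ d C E = d C D * s.
Proof.
move=> Ss; have [c [w [ac c1 cw]]] := apt_chart_pair (svalP C) (svalP D).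
exists (exist _ (c (w * s)) (apt_chart_chamber (w * s) ac)).
rewrite (dP ac c1 cw) (dP ac c1 (y := w * s))// (dP ac cw (y := w * s))//.
by rewrite mulKg mulgA.
Qed.

(** Otherwise [D] and [E] are equally far from [C]. Moving [C] one letter towards [D] and applying
    [d_weak] at both ends keeps them equally far, until [C] equals both. *)
Lemma d_strong s C D E : S s -> d D E = s -> len (d C D) < len (d C D * s) ->
  d C E = d C D * s.
Proof.
move=> Ss dDE H; have [ECE|//] := d_weak C Ss dDE; exfalso.
move Ew: (d C D) => w; rewrite Ew in H ECE.
elim/(@len_ind _ _ cox): w C Ew ECE H => [|r w Sr lrw IH] C Ew ECE H.
  move/d_eq: Ew => ECD; move/d_eq: ECE => ECE'; have : d D E = 1 by apply/d_eq; rewrite -ECD.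
  by rewrite dDE; exact: (simple_neq1 cox Ss).
have [F [dCF dDF]] := d_ex D C Sr.
have dFD : d F D = w by rewrite d_sym dDF d_sym Ew invgM invgK (simpleV cox Sr)
  (simple_mulK cox Sr).
have lws : len (r * w * s) <= (len (w * s)).+1 by rewrite -mulgA; exact: len_simple_mul.
have dFC : d C F = r by [].
have : d E F = d E C \/ d E F = d E C * r := d_weak E Sr dFC.
have : d F E = d F D \/ d F E = d F D * s := d_weak F Ss dDE.
rewrite (d_sym F E) (d_sym C E) ECE dFD.
have H' : len w < len (w * s).
  by rewrite -ltnS -lrw; apply: leq_trans H lws.
move=> E1 [] E2.
  have E3 : d F E = r * w by rewrite d_sym (d_sym F E) E2 invgK.
  case: E1; rewrite E3 => E4; first by move: lrw; rewrite E4 => /n_Sn.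
  by move: H; rewrite E4 (simple_mulKr cox Ss) -E4 lrw ltnNge leqnSn.
have dFE : d F E = w by rewrite d_sym (d_sym F E) E2 invgM invgK (simpleV cox Sr)
  (simple_mulK cox Sr).
exact: (IH F).
Qed.

Lemma building_weyl_distance : weyl_distance cox d.
Proof.
split; [exact: d_eq|exact: d_sym|exact: d_weak|exact: d_strong|exact: d_ex].
Qed.

End BuildingDistance.

(** * Isometric images of [W] form an apartment system *)

Section Apartments.
Variables (V : choiceType) (W : groupType) (S : set W).
Hypothesis cox : coxeter_system S.
Local Notation G := generated_subgroup.
Local Notation chart := (chart S).
Local Notation cotype := (cotype S).
Variables (Delta : set {fset V}) (Apts : set (set {fset V})) (tau : V -> W).
Hypothesis DA : apartment_system Delta Apts.
Hypothesis Ds : simplicial_complex Delta.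
Hypothesis lab : forall X, Apts X -> exists c, chart tau c /\ X = span c.
Local Notation Ch := (building_chamber Delta).
Variable d : Ch -> Ch -> W.
Hypothesis dP : forall C D c x y,
  apt_chart S Apts tau c -> c x = sval C -> c y = sval D -> d C D = x^-1 * y.

Let pair := apt_chart_pair DA lab.
Let faceP := face_d cox DA lab dP.
Let wd := building_weyl_distance cox DA lab dP.

Lemma isometry_chart f : isometry d f -> chart tau (fun w => sval (f w)).
Proof.
move=> fI; have H w : exists c, apt_chart S Apts tau c /\ c 1 = sval (f w).
  by have [c [_ [ac c1 _]]] := pair (svalP (f w)) (svalP (f w)); exists c.
split=> [w v|w u v|w s Ss|w w' v vw].
- by have [c [[cc _] <-]] := H w; move=> vw; exact: (chart_S cc vw).
- by have [c [[cc _] <-]] := H w; move=> uw vw; exact: (chart_inj cc uw vw).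
- by have [c [[cc _] <-]] := H w; exact: (chart_surj cc 1 Ss).
rewrite -fI -!fsub1set; rewrite -fsub1set in vw.
have -> : S `\ tau v = cotype tau [fset v]%fset; last exact: faceP.
apply/seteqP; split=> s [Ss Hs]; split=> //.
  by move=> u; rewrite inE => /eqP -> /esym.
by move=> E; apply: (Hs v); rewrite ?inE.
Qed.

Lemma chart_isometry c : apt_chart S Apts tau c ->
  exists2 f, isometry d f & c = (fun w => sval (f w)).
Proof.
move=> ac; exists (fun w => exist _ (c w) (apt_chart_chamber DA lab w ac)) => // x y.
exact: (dP ac).
Qed.

Definition isometry_apartments : set (set {fset V}) :=
  [set span (fun w => sval (f w)) | f in isometry d].

Lemma isometry_apartment_system : apartment_system Delta isometry_apartments.
Proof.
split=> [_ [f fI <-]|_ [f fI <-]|A B DelA DelB|_ _ A B [f fI <-] [g gI <-]].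
- split; first exact: span_simplicial.
  by move=> A [w Aw]; apply: (proj2 Ds) Aw; case: (svalP (f w)).
- exact: (span_coxeter cox (isometry_chart fI)).
- have [_ _ H _] := DA; have [X [AX XA XB]] := H _ _ DelA DelB.
  have [c [cc EX]] := lab AX; exists X; split=> //.
  have [|f fI Ec] := @chart_isometry c; first by split=> //; rewrite -EX.
  by exists f => //; rewrite EX Ec.
move=> [x Ax] [y By] [x' Ax'] [y' By'].
pose w := d (f x) (g y').
(* The shifts give [A] the coordinate 1 and [B] the coordinate [w] in both charts, so the
   isomorphism of [chart_iso] fixes both. *)
pose f' z := f (x * z); pose g' z := g (y' * w^-1 * z).
have f'I : isometry d f' by exact: isometryM.
have g'I : isometry d g' by exact: isometryM.
have Ef : span (fun z => sval (f z)) = span (fun z => sval (f' z)).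
  by rewrite -(spanM _ x).
have Eg : span (fun z => sval (g z)) = span (fun z => sval (g' z)).
  by rewrite -(spanM _ (y' * w^-1)).
have f'1 : f' 1 = f x by rewrite /f' mulg1.
have g'w : g' w = g y' by rewrite /g' mulgVK.
have [h [hiso hf]] := chart_iso (isometry_chart f'I) (isometry_chart g'I).
exists h; split; first by rewrite Ef Eg.
have A1 : (A `<=` sval (g' 1))%fset.
  have [z Az] : span (fun z => sval (g' z)) A by rewrite -Eg; exists x'.
  have H1 := proj1 (faceP (g' z) Ax) Az.
  have := wd_gen wd (g' w) (@cotype_S _ _ S tau A) H1.
  rewrite g'w (wd_sym wd (f x)) invgK -/w -g'w g'I mulVKg => Gz.
  apply/(faceP (g' 1) Az); rewrite g'I mulg1; exact: genV.
have Bw : (B `<=` sval (f' w))%fset.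
  have [z Bz] : span (fun z => sval (f' z)) B by rewrite -Ef; exists y.
  have H1 := proj1 (faceP (f' z) By') Bz.
  have := wd_gen wd (f' 1) (@cotype_S _ _ S tau B) H1.
  rewrite f'1 -/w -f'1 f'I invg1 mul1g => Gz.
  apply/(faceP (f' w) Bz); rewrite f'I -genVE invgM invgK; exact: Gz.
move=> v; rewrite inE => /orP[vA|vB].
  apply: (hf 1); last exact: (fsubsetP A1).
  by rewrite f'1; exact: (fsubsetP Ax).
apply: (hf w); first exact: (fsubsetP Bw).
by rewrite g'w; exact: (fsubsetP By').
Qed.

Lemma panel_avoid : (forall P, panel Delta P -> `I_4 #<= chambers_containing Delta P) ->
  forall (C : Ch) s (D E : Ch), S s -> exists F, [/\ d C F = s, F <> D & F <> E].
Proof.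
move=> D4 C s D E Ss; have [c [_ [ac c1 _]]] := pair (svalP C) (svalP C).
have [cc _] := ac; pose P := face tau (sval C) [set s].
have PC : (P `<=` sval C)%fset by exact: face_sub.
have Pp : panel Delta P.
  by exists (sval C); split=> //; [exact: svalP|rewrite -c1 (panel_card cc 1 Ss) /P -c1].
have [F [CF PF] nF] : exists2 F, chambers_containing Delta P F &
    F \notin [fset sval C; sval D; sval E]%fset.
  apply: contrapT => H.
  have sub : chambers_containing Delta P `<=` [set` [fset sval C; sval D; sval E]%fset].
    by move=> F PF; apply: contrapT => /negP nF; apply: H; exists F.
  have := leq_card_fset_set (finite_fset _) (card_le_trans (D4 _ Pp) (subset_card_le sub)).
  rewrite set_fsetK leqNgt => /negP; apply.
  apply: leq_ltn_trans (leq_card_fsetU _ _) _.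
  by rewrite cardfs2 cardfs1; case: (_ != _).
rewrite !inE !negb_or in nF; have /andP[/andP[FC FD] FE] := nF.
pose F' : Ch := exist _ F CF; exists F'; split.
- have [E1|//] := proj1 (d_face cox DA lab dP C F' Ss) PF.
  by move: FC; rewrite E1 eqxx.
- by move=> E1; move: FD; rewrite -E1 eqxx.
- by move=> E1; move: FE; rewrite -E1 eqxx.
Qed.

End Apartments.

(** * Convex subcomplexes as intersections of half-spaces *)

Section HalfSpaces.
Variables (V : choiceType) (W : groupType) (S : set W).
Hypothesis cox : coxeter_system S.
Local Notation G := generated_subgroup.
Local Notation N := (separates cox).
Local Notation len := (len cox).
Variables (tau : V -> W) (c : W -> {fset V}).
Hypothesis cc : chart S tau c.
Local Notation cot := (cotype S tau).
Local Notation X := (span c).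

Lemma chart_injective w w' : c w = c w' -> w = w'.
Proof. by move=> E; apply: (chart_sub_eq cox cc); rewrite E. Qed.

Lemma span_adjacent w D : adjacent X (c w) D <-> exists2 s, S s & D = c (w * s).
Proof.
split=> [[_ /chamber_span[w' ->] ne [P [[C [/chamber_span[y ->] Py cardP]] Pw Pw']]]|[s Ss ->]].
  have [v vw Pv] : exists2 v, v \in c w & P = (c w `\ v)%fset.
    have : #|` (c w `\` P)%fset| = 1%N.
      by rewrite cardfsD (fsetIidPr Pw) (chart_card2 w y cc cc) cardP subSnn.
    move=> /eqP /cardfs1P[v Ev]; have : v \in (c w `\` P)%fset by rewrite Ev inE.
    rewrite inE => /andP[vP vw]; exists v => //.
    by rewrite -Ev fsetDDr fsetDv fset0U (fsetIidPr Pw).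
  have Sv := chart_S cc vw; exists (tau v) => //.
  have Pf : P = face tau (c w) [set tau v].
    apply/fsetP => u; rewrite Pv !inE andbC; case uw: (u \in c w); rewrite ?andbF//= ?andbT.
    apply/idP/asboolPn => [/eqP uv E|E]; first by apply: uv; exact: (chart_inj cc uw vw).
    by apply/eqP => uv; apply: E; rewrite uv.
  rewrite Pf in Pw'; have [Ew|->//] := chart_panel cox cc Sv Pw'.
  by case: ne; rewrite Ew.
split; [exact: (span_chamber cox cc)|exact: (span_chamber cox cc)| |].
  move=> /chart_injective /(congr1 ( *%g w^-1)); rewrite mulKg mulVg => /esym.
  exact: (simple_neq1 cox Ss).
exists (face tau (c w) [set s]); split; [|exact: face_sub|exact: (chart_adj cox cc)].
by exists (c w); split; [exact: (span_chamber cox cc)|exact: face_sub|exact: (panel_card cc w Ss)].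
Qed.

Local Notation adj := (fun A B => `[< adjacent X A B >]).

Lemma path_word w p : path adj (c w) p -> exists2 u, last (c w) p = c (w * u) & len u <= size p.
Proof.
elim/last_ind: p => [_|p D IH]; first by exists 1; rewrite ?mulg1 ?len1.
rewrite rcons_path last_rcons size_rcons => /andP[/IH [u Eu lu] /asboolP].
rewrite Eu => /span_adjacent [s Ss ->]; exists (u * s); first by rewrite mulgA.
by apply: leq_trans (len_mul _ _ _) _; rewrite (len_simple cox Ss) addn1 ltnS.
Qed.

Lemma word_path w u : exists p, [/\ path adj (c w) p,
  last (c w) p = c (w * u) & size p = len u].
Proof.
elim/(@len_ind_r _ _ cox): u => [|s u Ss lus [p [pp lp sp]]].
  by exists [::]; rewrite mulg1 len1.
exists (rcons p (c (w * u * s))); rewrite rcons_path pp lp last_rcons size_rcons sp lus mulgA.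
by split=> //=; apply/asboolP/span_adjacent; exists s.
Qed.

(** [c (w * s)] is the last chamber but one of a minimal gallery from [c w'] to [c w]. *)
Lemma convex_step K w w' s : convex_chamber_subcomplex X K -> S s -> K (c w) -> K (c w') ->
  len (w'^-1 * (w * s)) < len (w'^-1 * w) -> K (c (w * s)).
Proof.
move=> [_ Kconv] Ss Kw Kw' lt.
have [p [pp lp sp]] := word_path w' (w'^-1 * (w * s)).
rewrite mulVKg in lp.
have adjw : adjacent X (c (w * s)) (c w).
  by apply/span_adjacent; exists s => //; rewrite -mulgA (simple_sq cox Ss) mulg1.
have gal : gallery X (c w') (rcons p (c w)).
  split; first exact: (span_chamber cox cc).
  by rewrite rcons_path pp lp; apply/asboolP.
have mg : minimal_gallery X (c w') (rcons p (c w)).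
  split=> // q [_ /path_word[u Eu lu]]; rewrite last_rcons Eu size_rcons sp => Ew.
  apply: leq_trans lu; apply: leq_trans lt _.
  by rewrite -(chart_injective Ew) mulKg.
have := mem_last (c w') p; rewrite inE lp => /orP[/eqP ->//|pin].
apply: (Kconv _ _ mg) => //; first by rewrite last_rcons.
by rewrite mem_rcons inE pin orbT.
Qed.

Lemma convex_chamber_ex K A : convex_chamber_subcomplex X K -> K A ->
  exists2 w, K (c w) & (A `<=` c w)%fset.
Proof.
move=> [[_ [Ks [n Kn] _ _] Kch] _] KA.
pose P m := `[< exists B, [/\ K B, (A `<=` B)%fset & #|` B| = m] >].
have exP : exists m, P m by exists #|` A|; apply/asboolP; exists A.
have ubP m : P m -> m <= n by move=> /asboolP [B [KB _ <-]]; exact: Kn.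
case: (ex_maxnP exP ubP) => m /asboolP[B [KB AB cB]] Bm.
have Bch : chamber K B.
  split=> // D KD BD; apply/eqP; rewrite eq_sym eqEfcard BD cB.
  by apply: Bm; apply/asboolP; exists D; split=> //; exact: fsubset_trans AB BD.
by have [w Ew] := chamber_span (Kch _ Bch); exists w; rewrite -Ew.
Qed.

(** Take a chamber [c w] of [K] and a chamber containing [A] at least distance; the first wall
    between them separates. By [convex_step] [K] stays on its side, and if a chamber containing [A]
    were on that side too, reflecting would shorten the distance. *)
Lemma convex_separate K x A : convex_chamber_subcomplex X K -> (A `<=` c x)%fset -> ~ K A ->
  exists t b, (forall w, K (c w) -> N w t = b) /\ (forall v, G (cot A) v -> N (x * v) t <> b).
Proof.
move=> Kc Ax nKA.
have [[_ [Ks _ _ _] _] _] := Kc.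
have [w0 Kw0 _] := convex_chamber_ex Kc (proj1 Ks).
pose P n := `[< exists w v, [/\ K (c w), G (cot A) v & len (w^-1 * (x * v)) = n] >].
have exP : exists n, P n.
  exists (len (w0^-1 * (x * 1))); apply/asboolP; exists w0, 1; split=> //; exact: gen1.
case: (ex_minnP exP) => n /asboolP[w [v [Kw Gv <-]]] nmin.
have {}nmin w' v' : K (c w') -> G (cot A) v' -> len (w^-1 * (x * v)) <= len (w'^-1 * (x * v')).
  by move=> Kw' Gv'; apply: nmin; apply/asboolP; exists w', v'.
have Ay : (A `<=` c (x * v))%fset by apply/(chart_sub cox cc _ Ax); rewrite mulKg.
have [s [u [Ss Eu lu]]] : exists s u, [/\ S s, w^-1 * (x * v) = s * u &
    len (s * u) = (len u).+1].
  move E: (w^-1 * (x * v)) => g; elim/(@len_ind _ _ cox): g E => [E|s u Ss lsu _ E].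
    case: nKA; apply: (proj2 Ks) Ay; suff <- : w = x * v by [].
    by rewrite -[x * v](mulVKg w) E mulg1.
  by exists s, u.
have Rt : reflection S (s ^ w^-1) by apply/reflJ/refl_simple.
have tw : s ^ w^-1 * w = w * s.
  by rewrite [LHS]conjgC conjgKV.
have nKws : ~ K (c (w * s)).
  move=> Kws; have := nmin _ _ Kws Gv.
  by rewrite invgM -mulgA Eu (simpleV cox Ss) (simple_mulK cox Ss) lu ltnn.
exists (s ^ w^-1), (N w (s ^ w^-1)); split=> [w' Kw'|v' Gv' E].
  have [//|/eqP ne] := pselect (N w' (s ^ w^-1) = N w (s ^ w^-1)).
  case: nKws; apply: (convex_step Kc Ss Kw Kw').
  by rewrite -tw mulgA; exact: len_fold.
have Nsu : N (s * u) s.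
  rewrite sep_mull; last exact: refl_simple.
  by apply/negP => /sep_ltn; rewrite lu ltnNge leqnSn.
have Ny := sep_diff cox w (x * v) (s ^ w^-1).
rewrite Eu conjgKV Nsu in Ny.
have := sep_diff cox (x * v) (x * v') (s ^ w^-1); rewrite E Ny invgM -mulgA mulKg => E2.
have Nv : N (v^-1 * v') ((s ^ w^-1) ^ (x * v)).
  by move: E2; case: (N w _); case: (N _ _).
have Gt := sep_gen (@cotype_S _ _ _ _ _) (genM (genV Gv) Gv') Nv.
have := nmin w _ Kw (genM Gv Gt); rewrite (mulgA x) -conjgC.
have -> : w^-1 * (s ^ w^-1 * (x * v)) = u.
  rewrite mulgA; have -> : w^-1 * s ^ w^-1 = s * w^-1 by rewrite -conjgC.
  by rewrite -mulgA Eu (simple_mulK cox Ss).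
by rewrite Eu lu ltnn.
Qed.

Lemma convex_half_spaces kappa : convex_subcomplex X kappa -> exists R : set (W * bool),
  forall x A, (A `<=` c x)%fset -> kappa A <-> convex_simplex cox R x (cot A).
Proof.
move=> [_ [F [_ Fc ->]]].
exists [set p | exists2 K, F K & forall w, K (c w) -> N w p.1 = p.2] => x A Ax.
split=> [kA t b [K FK /= Kt]|H K FK].
  have [w Kw Aw] := convex_chamber_ex (Fc _ FK) (kA _ FK).
  exists (x^-1 * w); first exact/(chart_sub cox cc _ Ax).
  by rewrite mulVKg; exact: Kt.
apply: contrapT => nKA; have [t [b [Kt At]]] := convex_separate (Fc _ FK) Ax nKA.
have [|v Gv Nv] := H t b; first by exists K.
exact: At Gv Nv.
Qed.

End HalfSpaces.

Theorem theorem2p3 (V : choiceType) (Delta Sigma : set {fset V}) :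
  building Delta ->
  (forall P, panel Delta P -> `I_4 #<= chambers_containing Delta P) ->
  apartment Delta Sigma ->
  forall kappa : set {fset V}, convex_subcomplex Sigma kappa ->
  exists Sigma' : set {fset V},
    apartment Delta Sigma' /\ kappa = Sigma `&` Sigma'.
Proof.
move=> [[Ds _ _ _] _] D4 [Apts DA ASigma] kappa kc.
have [_ coxA _ _] := DA.
have [Ss [W [S [cox [phi [phi_bij phi_sub]]]]]] := coxA _ ASigma.
have [tau0 [c0 [cc0 ES]]] := coxeter_chart Ss cox phi_bij phi_sub.
rewrite ES in ASigma.
have [tau lab] := labelling_base cox DA cc0 ASigma.
have [c [cc Ec]] := lab _ ASigma.
rewrite Ec in ASigma.
have {}ES : Sigma = span c by rewrite ES.
have [d dP] := weyl_distance_ex cox DA lab.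
have wd := building_weyl_distance cox DA lab dP.
have [a aI Ea] := chart_isometry DA lab dP (conj cc ASigma).
rewrite ES in kc *.
have [R RP] := convex_half_spaces cox cc kc.
have [Ks _] := kc; have k0 : kappa fset0 by case: Ks => [[]].
have R1 : convex_simplex cox R 1 S.
  have := proj1 (RP 1 fset0 (fsub0set _)) k0; rewrite cotype0; exact.
have thick := panel_avoid cox DA lab dP D4.
have [f [fI fin fout]] := convex_intersection wd thick aI R1.
exists (span (fun w => sval (f w))); split.
  exists (isometry_apartments d); last by exists f.
  exact: (isometry_apartment_system cox DA Ds lab dP).
have ca w : c w = sval (a w) by rewrite Ea.
apply/seteqP; split=> [A kA|A [[x Ax] [w Aw]]].
  have kX : span c A by case: Ks => _; apply.
  split=> //; have [x Ax] := kX; exists x.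
  have Aax := Ax; rewrite ca in Aax.
  apply/(face_d cox DA lab dP (f x) Aax); apply: fin; first exact: cotype_S.
  exact/(RP _ _ Ax).
have Aax := Ax; rewrite ca in Aax.
apply/(RP _ _ Ax); apply: (fout _ w); first exact: cotype_S.
exact/(face_d cox DA lab dP (f w) Aax).
Qed.
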